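(* Let $\Omega\subset\mathbb R^2$ be a bounded domain with smooth boundary, with $n=n(\Omega)$ holes, and let $A$ be a closed potential $1$-form on $\Omega$. Let $\Gamma=\{\Gamma_1,\dots,\Gamma_n\}$ be an admissible cut of $\Omega$ realizing the minimum in the definition of $h(\Omega)$, and let $h_j$ be the length of $\Gamma_j$, so that $h(\Omega)=\sum_{j=1}^n h_j$. Assume that $h(\Omega)\le\frac{|\Omega|}{2\pi}$ and $h_j\le1$ for each $j=1,\dots,n$. Then $$\lambda_1(\Omega,A)\le\frac{8\pi\, n(\Omega)}{|\Omega|}\sum_{j=1}^n\frac1{\left|\ln\frac{h_j}{2}\right|}.$$
   Context: A domain is a connected open set; $|\Omega|$ denotes its area. $\Omega$ has $n$ holes if its boundary consists of one outer closed curve and $n$ inner closed curves. An admissible cut of $\Omega$ (a domain with $n$ holes) is a collection of $n$ segments $\Gamma=\{\Gamma_1,\dots,\Gamma_n\}$ (straight line segments joining different connected components of the boundary of $\Omega$) such that $\Omega\setminus(\Gamma_1\cup\dots\cup\Gamma_n)$ is simply connected. The constant $h(\Omega)$ is $$h(\Omega)=\min\left\{\sum_{i=1}^n \mathrm{length}(\Gamma_i):\ \Gamma=\{\Gamma_1,\dots,\Gamma_n\}\text{ is an admissible cut of }\Omega\right\}.$$ A potential is a smooth real $1$-form $A$ (smooth up to the boundary of $\Omega$); it is closed if $dA=0$. For complex-valued $u$, set $\nabla^A u=\nabla u-iuA^\sharp$, where $A^\sharp$ is the vector field dual to $A$. The first eigenvalue of the magnetic Laplacian $\Delta_A=(\nabla^A)^\star\nabla^A$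 with magnetic Neumann boundary conditions ($\nabla^A_Nu=0$ on $\partial\Omega$) is $$\lambda_1(\Omega,A)=\min\left\{\frac{\int_\Omega|\nabla^A u|^2}{\int_\Omega|u|^2}:\ u\in H^1(\Omega,\mathbb C)\setminus\{0\}\right\}.$$ *)

(* Defs.v *)
From HB Require Import structures.
From mathcomp Require Import all_boot all_order all_algebra.
From mathcomp Require Import all_classical all_reals all_analysis.
From mathcomp.real_closed Require Import complex.
Set Implicit Arguments.
Unset Strict Implicit.
Unset Printing Implicit Defensive.
Import Order.TTheory GRing.Theory Num.Theory.
Import numFieldNormedType.Exports.
Local Open Scope classical_set_scope.
Local Open Scope ring_scope.
Local Open Scope complex_scope.

(* The plane is R * R.  Its canonical norm in the library is the sup norm; this
   only matters for lengths, which are therefore defined explicitly through the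
   Euclidean formula (open sets, continuity, differentiability and boundedness
   do not depend on the choice of the norm). *)

Notation lebesgue2 :=
  (product_measure1 (@lebesgue_measure _) (@lebesgue_measure _)).

Section PlaneGeometry.
Context {R : realType}.

Definition area (Omega : set (R * R)) : R := fine (lebesgue2 Omega).

Definition boundary {T : topologicalType} (X : set T) : set T :=
  closure X `\` interior X.

Definition segment (s : (R * R) * (R * R)) : set (R * R) :=
  [set s.1 + t *: (s.2 - s.1) | t in `[0 : R, 1]%classic].

Definition seg_length (s : (R * R) * (R * R)) : R :=
  Num.sqrt ((s.2.1 - s.1.1) ^+ 2 + (s.2.2 - s.1.2) ^+ 2).

Definition path_in {T : topologicalType} (U : set T) (c : R -> T) : Prop :=
  {within `[0 : R, 1]%classic, continuous c} /\
  (forall t, t \in `[0 : R, 1] -> U (c t)).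

Definition path_connected {T : topologicalType} (U : set T) : Prop :=
  forall x y, U x -> U y -> exists c, [/\ path_in U c, c 0 = x & c 1 = y].

(* H (s, t): s is the loop parameter, t the deformation parameter;
   the homotopy is relative to the base point c 0. *)
Definition null_homotopic {T : topologicalType} (U : set T) (c : R -> T) : Prop :=
  exists H : R * R -> T,
    {within `[0 : R, 1]%classic `*` `[0 : R, 1]%classic, continuous H} /\
    [/\ forall s t, s \in `[0 : R, 1] -> t \in `[0 : R, 1] -> U (H (s, t)),
        forall s, s \in `[0 : R, 1] -> H (s, 0) = c s,
        forall s, s \in `[0 : R, 1] -> H (s, 1) = c 0
      & forall t, t \in `[0 : R, 1] -> H (0, t) = c 0 /\ H (1, t) = c 0].

Definition simply_connected {T : topologicalType} (U : set T) : Prop :=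
  path_connected U /\
  forall c, path_in U c -> c 0 = c 1 -> null_homotopic U c.

(* Regular 1-periodic parametrization, injective on a period. *)
Definition smooth_closed_curve (c : R -> R * R) : Prop :=
  [/\ forall k t, derivable (derive1n k c) t 1,
      forall t, c (t + 1) = c t,
      {in `[0 : R, 1[ &, injective c}
    & forall t, derive1 c t != 0].

Definition inside (C : set (R * R)) : set (R * R) :=
  [set p | ~ C p /\ bounded_set (connected_component (~` C) p)].

Definition outside (C : set (R * R)) : set (R * R) :=
  [set p | ~ C p /\ ~ bounded_set (connected_component (~` C) p)].

(* c ord0 is the outer boundary curve, the c (lift ord0 i) are the inner ones.
   The inside/outside conditions also force Omega to lie locally on one side
   of each boundary curve. *)
Definition smooth_domain_with_holes (n : nat) (Omega : set (R * R)) : Prop :=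
  [/\ open Omega, connected Omega, bounded_set Omega
    & exists c : 'I_n.+1 -> R -> R * R,
      [/\ forall i, smooth_closed_curve (c i),
          trivIset setT (fun i => range (c i)),
          boundary Omega = \bigcup_i range (c i),
          Omega `<=` inside (range (c ord0))
        & forall i : 'I_n, Omega `<=` outside (range (c (lift ord0 i)))]].

Definition joins_boundary_components
    (Omega : set (R * R)) (s : (R * R) * (R * R)) : Prop :=
  [/\ boundary Omega s.1, boundary Omega s.2
    & connected_component (boundary Omega) s.1
      <> connected_component (boundary Omega) s.2].

(* A segment is given by the pair of its endpoints. *)
Definition admissible_cut (n : nat) (Omega : set (R * R))
    (Gamma : 'I_n -> (R * R) * (R * R)) : Prop :=
  (forall j, joins_boundary_components Omega (Gamma j)) /\
  simply_connected (Omega `\` \bigcup_j segment (Gamma j)).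

(* The minimum over admissible cuts, as an infimum of real numbers. *)
Definition cut_const (n : nat) (Omega : set (R * R)) : R :=
  inf [set \sum_j seg_length (Gamma j) |
       Gamma in @admissible_cut n Omega].

End PlaneGeometry.

Section MagneticEigenvalue.
Context {R : realType}.

Definition partial1 (f : R * R -> R) : R * R -> R :=
  'D_((1, 0) : R * R) f.
Definition partial2 (f : R * R -> R) : R * R -> R :=
  'D_((0, 1) : R * R) f.

Definition iter_partial (s : seq bool) (f : R * R -> R) : R * R -> R :=
  foldr (fun b g => if b then partial2 g else partial1 g) f s.

(* C^infinity on the open set U: every iterated partial derivative is
   differentiable (hence continuous) at every point of U. *)
Definition smooth_on_open (U : set (R * R)) (f : R * R -> R) : Prop :=
  forall s x, U x -> differentiable (iter_partial s f) x.

(* Smoothness on a set that need not be open: locally, f is the restriction of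
   a smooth function. *)
Definition smooth_on (X : set (R * R)) (f : R * R -> R) : Prop :=
  forall p, X p -> exists V g,
    [/\ open V, V p, smooth_on_open V g & {in V `&` X, f =1 g}].

(* A = (A1, A2) stands for the 1-form A1 dx + A2 dy. *)
Definition potential (Omega : set (R * R)) (A : R * R -> R * R) : Prop :=
  smooth_on (closure Omega) (fun x => (A x).1) /\
  smooth_on (closure Omega) (fun x => (A x).2).

Definition closed_form (Omega : set (R * R)) (A : R * R -> R * R) : Prop :=
  forall x, Omega x ->
    partial1 (fun y => (A y).2) x = partial2 (fun y => (A y).1) x.

Definition test_function (Omega : set (R * R)) (phi : R * R -> R) : Prop :=
  [/\ smooth_on_open setT phi,
      compact (closure [set x | phi x != 0])
    & closure [set x | phi x != 0] `<=` Omega].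

Definition sqmod (z : R[i]) : R := complex.Re z ^+ 2 + complex.Im z ^+ 2.

Definition L2_on (Omega : set (R * R)) (u : R * R -> R[i]) : Prop :=
  [/\ measurable_fun Omega (fun x => complex.Re (u x)),
      measurable_fun Omega (fun x => complex.Im (u x))
    & lebesgue2.-integrable Omega (fun x => (sqmod (u x))%:E)].

Definition weak_partial (Omega : set (R * R))
    (d : (R * R -> R) -> (R * R -> R)) (u g : R * R -> R) : Prop :=
  forall phi, test_function Omega phi ->
    \int[lebesgue2]_(x in Omega) (u x * d phi x)
    = - \int[lebesgue2]_(x in Omega) (g x * phi x).

Definition weak_partialC (Omega : set (R * R))
    (d : (R * R -> R) -> (R * R -> R)) (u g : R * R -> R[i]) : Prop :=
  weak_partial Omega d (fun x => complex.Re (u x)) (fun x => complex.Re (g x)) /\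
  weak_partial Omega d (fun x => complex.Im (u x)) (fun x => complex.Im (g x)).

(* u is in H^1(Omega, C), with weak gradient (g1, g2). *)
Definition H1_with_gradient (Omega : set (R * R))
    (u g1 g2 : R * R -> R[i]) : Prop :=
  [/\ L2_on Omega u, L2_on Omega g1, L2_on Omega g2,
      weak_partialC Omega partial1 u g1
    & weak_partialC Omega partial2 u g2].

(* |nabla^A u|^2 at a point where u = z, nabla u = (z1, z2), A = a. *)
Definition magnetic_gradient_sq (a : R * R) (z z1 z2 : R[i]) : R :=
  sqmod (z1 - 'i%C * z * a.1%:C) + sqmod (z2 - 'i%C * z * a.2%:C).

Definition rayleigh_quotients (Omega : set (R * R)) (A : R * R -> R * R) :
    set R :=
  [set r | exists u g1 g2,
    [/\ H1_with_gradient Omega u g1 g2,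
        ~ {ae lebesgue2, forall x, Omega x -> u x = 0}
      & r = (\int[lebesgue2]_(x in Omega)
                magnetic_gradient_sq (A x) (u x) (g1 x) (g2 x))
            / (\int[lebesgue2]_(x in Omega) sqmod (u x))]].

(* The minimum of the Rayleigh quotient, as an infimum of real numbers. *)
Definition lambda1 (Omega : set (R * R)) (A : R * R -> R * R) : R :=
  inf (rayleigh_quotients Omega A).

End MagneticEigenvalue.

(* Main.v *)
Require Import Defs.
From mathcomp Require Import all_boot all_order all_algebra.
From mathcomp Require Import all_classical all_reals all_analysis.
From mathcomp Require Import ring lra.
From mathcomp.real_closed Require Import complex.
Import Order.TTheory GRing.Theory Num.Theory.
Import numFieldNormedType.Exports.
Local Open Scope classical_set_scope.
Local Open Scope ring_scope.

(** On the cut domain, which is simply connected, the closed form A has a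
    primitive phi, so the unit field exp(i phi) has zero magnetic gradient
    there.  Multiply it by a cutoff Psi, the product of one radial cutoff for
    each segment of the cut: the factor for a segment of length h vanishes on
    the disc of diameter h around its midpoint, which contains the segment, and
    equals 1 outside the concentric disc of radius sqrt (h / 2).  Then
    u = Psi exp(i phi) is C^1 on the whole domain and its magnetic gradient has
    modulus |grad Psi|, so its Rayleigh quotient is the Dirichlet energy of Psi
    over the mass of Psi.  With a smoothstep in the logarithm of the radius a
    single factor has energy (24/5) pi / |ln (h/2)|, computed as the flux of a
    radial field through a square; Cauchy-Schwarz for the product costs the
    factor n; and the mass lost is at most the sum of the numbers 2 h, hence at
    most |Omega| / pi.  The constant 8 follows from 24/5 <= 8 (1 - 1/pi). *)

(** * Directional derivatives *)

(** The paths and homotopies that define simple connectivity are merely continuous, so A cannot be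
    integrated along them. Only differences of values of local primitives are used: they are added
    along subdivisions so fine that each piece lies in a ball carrying a primitive, and homotopy
    invariance becomes cancellation around the cells of a grid.

    Nothing is known of the primitive on the cut, so the cutoff has to vanish in a whole
    neighbourhood of each point of the cut in the domain. The inner disc has this property because a
    segment touches its bounding circle only at its end points, and these lie on the boundary of the
    domain, hence outside the domain.

    A cutoff affine in the logarithm of the radius has energy 4 pi / |ln (h/2)| but is only
    Lipschitz. The smoothstep costs a factor 6/5, whence 24/5, and makes everything C^1: weak
    derivatives are then classical ones, and the integrals over the plane reduce to the fundamental
    theorem of calculus on boxes. The slack between 4 and 8 (1 - 1/pi) pays for this factor, since
    24/5 <= 8 (1 - 1/pi) says exactly that pi >= 5/2. *)

Section directional_derivatives.
Context {R : realType}.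
Set Implicit Arguments.
Unset Strict Implicit.

(** The two difference quotients are the same function of h, so one-variable calculus applies along
    lines. *)
Lemma is_derive_line {V : normedModType R} (f : V -> R) (x v : V) (d : R) :
  is_derive x v f d <-> is_derive (0 : R) 1 (fun t : R => f (t *: v + x)) d.
Proof.
have E : (fun h : R => h^-1 *: (f (h *: v + x) - f x)) =
    (fun h : R => h^-1 *: ((fun t : R => f (t *: v + x)) (h *: 1 + 0)
       - (fun t : R => f (t *: v + x)) 0)).
  by apply/funext => h; rewrite addr0 scaler1 scale0r add0r.
split=> -[fd fdE]; split.
- by rewrite /derivable -E.
- by rewrite -fdE /derive -E.
- by rewrite /derivable E.
- by rewrite -fdE /derive E.
Qed.

Lemma is_derive_comp_dir {V : normedModType R} (g : R -> R) (f : V -> R)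
    (x v : V) (a b : R) :
  is_derive (f x) 1 g a -> is_derive x v f b ->
  is_derive x v (fun y => g (f y)) (a * b).
Proof.
move=> ga /is_derive_line fb; apply/is_derive_line.
apply: (@is_derive1_comp _ g (fun t : R => f (t *: v + x))).
by rewrite scale0r add0r.
Qed.

Lemma is_derive_slice1 (f : R * R -> R) (x y d : R) :
  is_derive (x, y) (1, 0) f d <-> is_derive x 1 (fun s => f (s, y)) d.
Proof.
rewrite (is_derive_line f) (is_derive_line (fun s => f (s, y))).
suff -> : (fun t : R => f (t *: (1, 0) + (x, y))) =
  (fun t : R => f (t *: 1 + x, y)) by [].
apply/funext => t; congr (f _).
by congr pair; rewrite /= ?scaler0 ?add0r.
Qed.

Lemma is_derive_slice2 (f : R * R -> R) (x y d : R) :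
  is_derive (x, y) (0, 1) f d <-> is_derive y 1 (fun s => f (x, s)) d.
Proof.
rewrite (is_derive_line f) (is_derive_line (fun s => f (x, s))).
suff -> : (fun t : R => f (t *: (0, 1) + (x, y))) =
  (fun t : R => f (x, t *: 1 + y)) by [].
apply/funext => t; congr (f _).
by congr pair; rewrite /= ?scaler0 ?add0r.
Qed.

Lemma is_derive_val {V : normedModType R} (f : V -> R) (x v : V) (a b : R) :
  is_derive x v f a -> a = b -> is_derive x v f b.
Proof. by move=> + <-. Qed.

Lemma is_deriveD_fun {V : normedModType R} (f g : V -> R) (x v : V) (a b : R) :
  is_derive x v f a -> is_derive x v g b ->
  is_derive x v (fun y => f y + g y) (a + b).
Proof. exact: is_deriveD. Qed.

Lemma is_deriveM_fun {V : normedModType R} (f g : V -> R) (x v : V) (a b : R) :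
  is_derive x v f a -> is_derive x v g b ->
  is_derive x v (fun y => f y * g y) (a * g x + f x * b).
Proof.
move=> fa gb; have H := is_deriveM fa gb.
apply: (is_derive_val H).
by rewrite /GRing.scale/= addrC mulrC.
Qed.

Lemma is_derive_cst_fun {V : normedModType R} (c : R) (x v : V) :
  is_derive x v (fun=> c) 0.
Proof. exact: is_derive_cst. Qed.

Lemma is_deriveX_fun {V : normedModType R} (f : V -> R) (n : nat) (x v : V) (d : R) :
  is_derive x v f d ->
  is_derive x v (fun y => f y ^+ n.+1) (n.+1%:R * f x ^+ n * d).
Proof.
move=> fd; elim: n => [|n IH]; first by rewrite expr0 !mul1r.
under eq_fun do rewrite exprS.
apply: is_derive_val (is_deriveM_fun fd IH) _.
by rewrite -[in RHS]natr1 exprS; ring.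
Qed.

Lemma is_derive_near0 {V : normedModType R} (f : V -> R) (x v : V) :
  (\near x, f x = 0) -> is_derive x v f 0.
Proof.
move=> f0; apply: near_eq_is_derive (is_derive_cst_fun 0 x v).
by apply: filterS f0 => y ->.
Qed.

Lemma is_derive_fst1 (p : R * R) : is_derive p (1, 0) fst (1 : R).
Proof. by case: p => x y; apply/is_derive_slice1. Qed.

Lemma is_derive_fst2 (p : R * R) : is_derive p (0, 1) fst (0 : R).
Proof. by case: p => x y; apply/is_derive_slice2; exact: is_derive_cst. Qed.

Lemma is_derive_snd1 (p : R * R) : is_derive p (1, 0) snd (0 : R).
Proof. by case: p => x y; apply/is_derive_slice1; exact: is_derive_cst. Qed.

Lemma is_derive_snd2 (p : R * R) : is_derive p (0, 1) snd (1 : R).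
Proof. by case: p => x y; apply/is_derive_slice2. Qed.

(** Leibniz rule. The list is duplicate-free because the cofactor is selected by [k != i], which
    would discard every occurrence of a repeated index. *)
Lemma is_derive_prod {V : normedModType R} (I : eqType) (s : seq I) (f : I -> V -> R) (x v : V)
    (d : I -> R) :
  uniq s ->
  (forall i, is_derive x v (f i) (d i)) ->
  is_derive x v (fun y => \prod_(i <- s) f i y)
    (\sum_(i <- s) d i * \prod_(k <- s | k != i) f k x).
Proof.
move=> + fd; elim: s => [_|a s IH /= /andP[anis us]].
  rewrite big_nil; under eq_fun do rewrite big_nil.
  exact: is_derive_cst_fun.
under eq_fun do rewrite big_cons.
apply: is_derive_val; first exact: (is_deriveM_fun (fd a) (IH us)).
rewrite [RHS]big_cons big_cons eqxx/=; congr (_ * _ + _).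
  rewrite [RHS]big_seq_cond [LHS]big_seq; apply: eq_bigl => k.
  by have [ks|//] := boolP (k \in s); apply/esym/eqP => ka; rewrite -ka ks in anis.
rewrite mulr_sumr [LHS]big_seq [RHS]big_seq; apply: eq_bigr => i si.
rewrite big_cons; case: eqP => [ai|_]; first by rewrite ai si in anis.
by rewrite mulrCA.
Qed.

End directional_derivatives.

(** * Lebesgue measure on the plane *)

Section plane_topology_measure.
Context {R : realType}.
Set Implicit Arguments.
Unset Strict Implicit.
Local Notation mu2 := (product_measure1 (@lebesgue_measure R) (@lebesgue_measure R)).

Lemma ball2E (p q : R * R) (e : R) :
  ball p e q <-> (`|p.1 - q.1| < e) /\ (`|p.2 - q.2| < e).
Proof. by []. Qed.

Lemma nbhs2P (p : R * R) (A : set (R * R)) :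
  nbhs p A <-> exists2 e, 0 < e & ball p e `<=` A.
Proof.
by rewrite nbhs_ballP; split=> -[e e0 pe]; exists e.
Qed.

(** An open set is the union of the open boxes with rational corners that it contains, and there are
    countably many of these. *)
Lemma open_measurable2 (U : set (R * R)) : open U -> measurable U.
Proof.
move=> oU.
pose B (q : (rat * rat) * (rat * rat)) : set (R * R) :=
  `]ratr q.1.1, ratr q.1.2[%classic `*` `]ratr q.2.1, ratr q.2.2[%classic.
have -> : U = \bigcup_q (if `[< B q `<=` U >] then B q else set0).
  apply/seteqP; split=> [[x y] Uxy|p [q _]]; last first.
    by case: asboolP => [BU /BU|_ []].
  have /nbhs2P[e e0 eU] : nbhs (x, y) U by exact: open_nbhs_nbhs.
  have [a] : exists q, ratr q \in `]x - e, x[ by apply: rat_in_itvoo; lra.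
  have [b] : exists q, ratr q \in `]x, x + e[ by apply: rat_in_itvoo; lra.
  have [c] : exists q, ratr q \in `]y - e, y[ by apply: rat_in_itvoo; lra.
  have [d] : exists q, ratr q \in `]y, y + e[ by apply: rat_in_itvoo; lra.
  rewrite !in_itv/= => /andP[yd dy] /andP[cy yc] /andP[xb bx] /andP[ax xa].
  exists ((a, b), (c, d)) => //; case: asboolP; last first.
    case=> -[x' y'] [] /=; rewrite !in_itv/= => /andP[ax' xb'] /andP[cy' yd'].
    apply: eU; apply/ball2E => /=; split.
      by rewrite ltr_norml; apply/andP; split; lra.
    by rewrite ltr_norml; apply/andP; split; lra.
  by move=> _; split; rewrite /= in_itv/=; apply/andP.
apply: countable_bigcupT_measurable => [|q]; first exact: countableP.
by case: ifP => // _; apply: measurableX.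
Qed.

(** Continuity at the points of [D] refers to the whole plane, so within [D] the preimage of an open
    interval coincides with its interior. *)
Lemma measurable_fun_cts (D : set (R * R)) (f : R * R -> R) :
  measurable D -> (forall x, D x -> {for x, continuous f}) ->
  measurable_fun D f.
Proof.
move=> mD cf; apply: (measurability _ (measurable_realfun.RGenOpens.measurableE R)).
move=> _ [_ [a [b ->] <-]].
have -> : D `&` f @^-1` `]a, b[%classic =
    D `&` interior (f @^-1` `]a, b[%classic).
  apply/seteqP; split=> x [Dx fx]; split=> //.
    by apply: cf => //; apply: open_nbhs_nbhs; split=> //; exact: interval_open.
  exact: interior_subset fx.
by apply: measurableI => //; apply: open_measurable2; exact: open_interior.
Qed.

Definition box (a b c d : R) : set (R * R) :=
  `[a, b]%classic `*` `[c, d]%classic.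

Lemma boxE (a b c d x y : R) :
  box a b c d (x, y) <-> [/\ a <= x, x <= b, c <= y & y <= d].
Proof.
rewrite /box/=; split=> [[]|[ax xb cy yd]]; rewrite /= !in_itv/=.
  by move=> /andP[? ?] /andP[? ?]; split.
by split; apply/andP.
Qed.

Lemma measurable_box (a b c d : R) : measurable (box a b c d).
Proof. exact: measurableX. Qed.

Lemma compact_box (a b c d : R) : compact (box a b c d).
Proof. by apply: compact_setX; exact: segment_compact. Qed.

Lemma lebesgue_segment (a b : R) : a <= b ->
  @lebesgue_measure R `[a, b]%classic = (b - a)%:E.
Proof.
move=> ab; rewrite lebesgue_measure_itv/= lte_fin; case: ltP => [_|ba].
  by rewrite EFinB.
by have -> : b = a; [lra|rewrite subrr].
Qed.

Lemma lebesgue2_box (a b c d : R) : a <= b -> c <= d ->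
  mu2 (box a b c d) = ((b - a) * (d - c))%:E.
Proof.
move=> ab cd; rewrite product_measure1E//=.
rewrite EFinM; congr (_ * _)%E; exact: lebesgue_segment.
Qed.

Lemma lebesgue2_box_lty (a b c d : R) : (mu2 (box a b c d) < +oo)%E.
Proof.
have [ab|ba] := leP a b; last first.
  by rewrite (_ : box _ _ _ _ = set0) ?measure0// -subset0 => -[x y] /boxE[]; lra.
have [cd|dc] := leP c d; last first.
  by rewrite (_ : box _ _ _ _ = set0) ?measure0// -subset0 => -[x y] /boxE[]; lra.
by rewrite lebesgue2_box// ltry.
Qed.

Lemma bounded_set_box (D : set (R * R)) :
  bounded_set D -> exists2 M, 0 < M & D `<=` box (- M) M (- M) M.
Proof.
move=> [M [Mr bD]]; exists (`|M| + 1); first by rewrite ltr_wpDl.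
move=> [x y] Dxy.
have := bD (`|M| + 1) _ _ Dxy.
rewrite (le_lt_trans (ler_norm M)) ?ltrDl// => /(_ isT).
rewrite /= /Num.norm/= /Num.norm/= ge_max !ler_norml => /andP[/andP[? ?] /andP[? ?]].
by apply/boxE.
Qed.

Lemma bounded_integrable2 (D : set (R * R)) (f : R * R -> R) (M : R) :
  measurable D -> bounded_set D -> measurable_fun D f ->
  (forall x, D x -> `|f x| <= M) -> mu2.-integrable D (EFin \o f).
Proof.
move=> mD bD mf fM; apply: measurable_bounded_integrable => //.
  have [N _ DN] := bounded_set_box bD.
  apply: (le_lt_trans _ (lebesgue2_box_lty (- N) N (- N) N)).
  by apply: le_measure; rewrite ?inE//; exact: measurable_box.
exists M; split; first exact: num_real.
by move=> N MN x Dx /=; exact: le_trans (fM _ Dx) (ltW MN).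
Qed.

Lemma bounded_box (a b c d : R) : bounded_set (box a b c d).
Proof. exact/compact_bounded/compact_box. Qed.

Lemma compact_bound (K : set (R * R)) (f : R * R -> R) :
  compact K -> (forall x, K x -> {for x, continuous f}) ->
  exists M, forall x, K x -> `|f x| <= M.
Proof.
move=> cK cf.
have cfK : compact (f @` K).
  apply: continuous_compact => //; apply: continuous_in_subspaceT => x.
  by rewrite inE => /cf.
have [M [Mr bM]] := compact_bounded cfK.
exists (M + 1) => x Kx.
by apply: (bM (M + 1)); [rewrite ltrDl|exists x].
Qed.

Lemma integrable_box (f : R * R -> R) (a b c d : R) :
  (forall x, box a b c d x -> {for x, continuous f}) ->
  mu2.-integrable (box a b c d) (EFin \o f).
Proof.
move=> cf; have [M fM] := compact_bound (@compact_box a b c d) cf.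
apply: (@bounded_integrable2 _ _ M) => //; first exact: measurable_box.
- exact: bounded_box.
- by apply: measurable_fun_cts => //; exact: measurable_box.
Qed.

End plane_topology_measure.

(** * Fubini and Green's formula on rectangles *)

Section green.
Context {R : realType}.
Set Implicit Arguments.
Unset Strict Implicit.
Local Notation mu := (@lebesgue_measure R).
Local Notation mu2 := (product_measure1 (@lebesgue_measure R) (@lebesgue_measure R)).

Lemma continuous_slice1 (f : R * R -> R) (x y : R) :
  {for (x, y), continuous f} -> {for x, continuous (fun s => f (s, y))}.
Proof.
move=> cf; apply: (@continuous_comp _ _ _ (fun s : R => (s, y)) f) => //.
exact: (cvg_pair (@cvg_id _ (nbhs x)) (cvg_cst y)).
Qed.

Lemma continuous_slice2 (f : R * R -> R) (x y : R) :
  {for (x, y), continuous f} -> {for y, continuous (fun s => f (x, s))}.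
Proof.
move=> cf; apply: (@continuous_comp _ _ _ (fun s : R => (x, s)) f) => //.
exact: (cvg_pair (cvg_cst x) (@cvg_id _ (nbhs y))).
Qed.

Lemma FTC2_is_derive (f F : R -> R) (a b : R) : a <= b ->
  (forall x, a <= x <= b -> {for x, continuous F}) ->
  (forall x, a <= x <= b -> is_derive x 1 f (F x)) ->
  (\int[mu]_(x in `[a, b]) (F x)%:E = (f b - f a)%:E)%E.
Proof.
rewrite le_eqVlt => /predU1P[<- _ _|ab cF df].
  by rewrite set_itv1 integral_set1 subrr.
have cf x : a <= x <= b -> {for x, continuous f}.
  by move=> /df[dfx _]; apply: differentiable_continuous; exact/derivable1_diffP.
rewrite (@continuous_FTC2 _ _ f)//.
- apply: continuous_in_subspaceT => x; rewrite inE/= in_itv/=; exact: cF.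
- split.
  + by move=> x; rewrite in_itv/= => /andP[ax xb]; have [] := df x _; rewrite ?ltW.
  + by apply: cvg_at_right_filter; apply: cf; rewrite lexx ltW.
  + by apply: cvg_at_left_filter; apply: cf; rewrite lexx ltW.
- move=> x; rewrite in_itv/= => /andP[ax xb]; have [] := df x _; rewrite ?ltW//.
  by rewrite derive1E.
Qed.

Lemma box_fubini1 (F : R * R -> R) (a b c d : R) :
  (forall p, box a b c d p -> {for p, continuous F}) ->
  (\int[mu2]_(p in box a b c d) (F p)%:E =
   \int[mu]_(y in `[c, d]) \int[mu]_(x in `[a, b]) (F (x, y))%:E)%E.
Proof.
move=> cF; rewrite integral_mkcond -integral21_prod_meas1/=; last first.
  apply/integrable_restrict; rewrite ?setTI//; first exact: measurable_box.
  exact: integrable_box.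
rewrite [RHS]integral_mkcond; apply: eq_integral => y _; rewrite patchE.
case: ifPn => [ycd|ycd]; rewrite /fubini_G.
  rewrite [RHS]integral_mkcond; apply: eq_integral => x _; rewrite !patchE.
  suff -> : ((x, y) \in box a b c d) = (x \in `[a, b]%classic) by [].
  by rewrite /box in_setX/= ycd andbT.
under eq_integral => x _.
  rewrite patchE /box in_setX/= (negbTE ycd) andbF; over.
exact: integral0.
Qed.

Lemma box_fubini2 (F : R * R -> R) (a b c d : R) :
  (forall p, box a b c d p -> {for p, continuous F}) ->
  (\int[mu2]_(p in box a b c d) (F p)%:E =
   \int[mu]_(x in `[a, b]) \int[mu]_(y in `[c, d]) (F (x, y))%:E)%E.
Proof.
move=> cF; rewrite integral_mkcond -integral12_prod_meas1/=; last first.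
  apply/integrable_restrict; rewrite ?setTI//; first exact: measurable_box.
  exact: integrable_box.
rewrite [RHS]integral_mkcond; apply: eq_integral => x _; rewrite patchE.
case: ifPn => [xab|xab]; rewrite /fubini_F.
  rewrite [RHS]integral_mkcond; apply: eq_integral => y _; rewrite !patchE.
  suff -> : ((x, y) \in box a b c d) = (y \in `[c, d]%classic) by [].
  by rewrite /box in_setX/= xab.
under eq_integral => y _.
  rewrite patchE /box in_setX/= (negbTE xab); over.
exact: integral0.
Qed.

Lemma integral_partial1_box (f F : R * R -> R) (a b c d : R) : a <= b ->
  (forall p, box a b c d p -> {for p, continuous F}) ->
  (forall p, box a b c d p -> is_derive p (1, 0) f (F p)) ->
  \int[mu2]_(p in box a b c d) F p =
  \int[mu]_(y in `[c, d]) (f (b, y) - f (a, y)).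
Proof.
move=> ab cF df; rewrite /Rintegral box_fubini1//; congr fine.
apply: eq_integral => y; rewrite inE/= in_itv/= => /andP[cy yd].
apply: (@FTC2_is_derive (fun s => f (s, y))) => // x /andP[ax xb].
  by apply: continuous_slice1; apply: cF; exact/boxE.
by apply/is_derive_slice1; apply: df; exact/boxE.
Qed.

Lemma integral_partial2_box (f F : R * R -> R) (a b c d : R) : c <= d ->
  (forall p, box a b c d p -> {for p, continuous F}) ->
  (forall p, box a b c d p -> is_derive p (0, 1) f (F p)) ->
  \int[mu2]_(p in box a b c d) F p =
  \int[mu]_(x in `[a, b]) (f (x, d) - f (x, c)).
Proof.
move=> cd cF df; rewrite /Rintegral box_fubini2//; congr fine.
apply: eq_integral => x; rewrite inE/= in_itv/= => /andP[ax xb].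
apply: (@FTC2_is_derive (fun s => f (x, s))) => // y /andP[cy yd].
  by apply: continuous_slice2; apply: cF; exact/boxE.
by apply/is_derive_slice2; apply: df; exact/boxE.
Qed.

Lemma integrable_segment (f : R -> R) (a b : R) :
  (forall x, a <= x <= b -> {for x, continuous f}) ->
  mu.-integrable `[a, b] (EFin \o f).
Proof.
move=> cf; apply: continuous_compact_integrable; first exact: segment_compact.
by apply: continuous_in_subspaceT => x; rewrite inE/= in_itv/=; exact: cf.
Qed.

(** The double integral of the common derivative [D], computed in both orders. The two sides are the
    integrals of P dx + Q dy along the two L-shaped routes from (a, c) to (b, d). *)
Lemma rectangle_closed_form (P Q D : R * R -> R) (a b c d : R) :
  a <= b -> c <= d ->
  (forall p, box a b c d p -> {for p, continuous P}) ->
  (forall p, box a b c d p -> {for p, continuous Q}) ->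
  (forall p, box a b c d p -> {for p, continuous D}) ->
  (forall p, box a b c d p -> is_derive p (0, 1) P (D p)) ->
  (forall p, box a b c d p -> is_derive p (1, 0) Q (D p)) ->
  \int[mu]_(x in `[a, b]) P (x, c) + \int[mu]_(y in `[c, d]) Q (b, y) =
  \int[mu]_(y in `[c, d]) Q (a, y) + \int[mu]_(x in `[a, b]) P (x, d).
Proof.
move=> ab cd cP cQ cD dP dQ.
have := integral_partial1_box ab cD dQ.
rewrite (integral_partial2_box cd cD dP).
rewrite RintegralB//; last 2 first.
- by apply: integrable_segment => x /andP[? ?]; apply: continuous_slice1; apply: cP; exact/boxE.
- by apply: integrable_segment => x /andP[? ?]; apply: continuous_slice1; apply: cP; exact/boxE.
rewrite RintegralB//; last 2 first.
- by apply: integrable_segment => x /andP[? ?]; apply: continuous_slice2; apply: cQ; exact/boxE.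
- by apply: integrable_segment => x /andP[? ?]; apply: continuous_slice2; apply: cQ; exact/boxE.
lra.
Qed.

End green.

(** * Primitives of closed forms *)

Section local_primitive.
Context {R : realType}.
Set Implicit Arguments.
Unset Strict Implicit.
Local Notation mu := (@lebesgue_measure R).

Definition is_primitive (P Q : R * R -> R) (B : set (R * R)) (F : R * R -> R) :=
  forall p, B p -> is_derive p (1, 0) F (P p) /\ is_derive p (0, 1) F (Q p).

Lemma is_derive_continuous (f : R -> R) (x d : R) :
  is_derive x 1 f d -> {for x, continuous f}.
Proof.
by move=> [dfx _]; apply: differentiable_continuous; exact/derivable1_diffP.
Qed.

(** The ends come in no fixed order because displacements from a centre may have either sign. *)
Lemma mean_value_le (h dh : R -> R) (M u v : R) :
  (forall s, Num.min u v <= s <= Num.max u v ->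
     is_derive s 1 h (dh s) /\ `|dh s| <= M) ->
  `|h v - h u| <= M * `|v - u|.
Proof.
wlog uv : u v / u <= v => [H dhM|].
  have [/H|/ltW vu] := leP u v; first exact.
  by rewrite distrC (distrC v); apply: H => // s; rewrite minC maxC => /dhM.
rewrite (min_idPl uv) (max_idPr uv) => dhM.
have [||c] := @MVT_segment _ h dh _ _ uv.
- by move=> s; rewrite in_itv/= => /andP[us sv]; apply dhM; rewrite !ltW.
- apply: continuous_in_subspaceT => s; rewrite inE/= in_itv/= => usv.
  exact: (is_derive_continuous (dhM _ usv).1).
- rewrite in_itv/= => ucv ->; rewrite normrM ler_wpM2r//.
  exact: (dhM _ ucv).2.
Qed.

Lemma between_dist (c u v s e : R) : `|c - u| < e -> `|c - v| < e ->
  Num.min u v <= s <= Num.max u v -> `|c - s| < e.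
Proof.
rewrite !ltr_norml => /andP[? ?] /andP[? ?]; rewrite /Num.min /Num.max.
by case: ifP => _ /andP[? ?]; apply/andP; split; lra.
Qed.

(** Balls of the sup norm are squares, so the route from p to q through (q1, p2) with sides parallel
    to the axes stays in both balls; [F - G] has zero derivative along each leg. *)
Lemma primitive_increment_unique (P Q F G : R * R -> R) (y z : R * R) (r s : R)
    (p q : R * R) :
  is_primitive P Q (ball y r) F -> is_primitive P Q (ball z s) G ->
  ball y r p -> ball z s p -> ball y r q -> ball z s q ->
  F q - F p = G q - G p.
Proof.
case: p q => [p1 p2] [q1 q2] pF pG.
move=> /ball2E[/= yp1 yp2] /ball2E[/= zp1 zp2] /ball2E[/= yq1 yq2] /ball2E[/= zq1 zq2].
have dH x : ball y r x -> ball z s x -> is_derive x (1, 0) (fun w => F w - G w) 0 /\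
    is_derive x (0, 1) (fun w => F w - G w) 0.
  move=> /pF[F1 F2] /pG[G1 G2]; split.
    by apply: is_derive_val (is_deriveB F1 G1) _; rewrite subrr.
  by apply: is_derive_val (is_deriveB F2 G2) _; rewrite subrr.
have H1 : `|(F (q1, p2) - G (q1, p2)) - (F (p1, p2) - G (p1, p2))| <= 0 * `|q1 - p1|.
  apply: (@mean_value_le (fun x => F (x, p2) - G (x, p2)) (fun=> 0)) => x px.
  rewrite normr0; split=> //.
  apply: (is_derive_slice1 (fun w => F w - G w) x p2 0).1; apply dH; apply/ball2E => /=.
    by split=> //; exact: between_dist px.
  by split=> //; exact: between_dist px.
have H2 : `|(F (q1, q2) - G (q1, q2)) - (F (q1, p2) - G (q1, p2))| <= 0 * `|q2 - p2|.
  apply: (@mean_value_le (fun x => F (q1, x) - G (q1, x)) (fun=> 0)) => x px.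
  rewrite normr0; split=> //.
  apply: (is_derive_slice2 (fun w => F w - G w) q1 x 0).1; apply dH; apply/ball2E => /=.
    by split=> //; exact: between_dist px.
  by split=> //; exact: between_dist px.
move: H1 H2; rewrite !mul0r !normr_le0 => /eqP H1 /eqP H2; lra.
Qed.

(** Partial derivatives alone do not give continuity. Here they are bounded near p, because P and Q
    are continuous there, and the mean value inequality along two legs gives a Lipschitz
    estimate. *)
Lemma primitive_continuous (P Q F : R * R -> R) (p : R * R) (r : R) : 0 < r ->
  is_primitive P Q (ball p r) F ->
  {for p, continuous P} -> {for p, continuous Q} -> {for p, continuous F}.
Proof.
case: p => [p1 p2] r0 pF cP cQ.
have [e1 e10 eP] : exists2 e, 0 < e & ball (p1, p2) e `<=` [set x | `|P (p1, p2) - P x| < 1].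
  by apply/nbhs2P; apply: (cvgr_dist_lt _ _ cP).
have [e2 e20 eQ] : exists2 e, 0 < e & ball (p1, p2) e `<=` [set x | `|Q (p1, p2) - Q x| < 1].
  by apply/nbhs2P; apply: (cvgr_dist_lt _ _ cQ).
(* A bound for both |P| and |Q| wherever they differ by less than 1 from their values at p. *)
pose M := `|P (p1, p2)| + `|Q (p1, p2)| + 1.
have M0 : 0 < M by rewrite ltr_wpDl// addr_ge0.
apply/cvgrPdist_lt => e e0.
pose d := Num.min r (Num.min e1 (Num.min e2 (e / (2 * M)))).
have d0 : 0 < d by rewrite !lt_min r0 e10 e20 divr_gt0// mulr_gt0.
apply/nbhs2P; exists d => // -[x y] /ball2E[/=].
rewrite !lt_min => /and4P[x1 x2 x3 x4] /and4P[y1 y2 y3 y4].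
have pp (u : R) t : 0 < t -> `|u - u| < t by rewrite subrr normr0.
have bd (f g : R) : `|f - g| < 1 -> `|g| <= `|f| + 1.
  move=> fg; rewrite -lerBlDl (le_trans (lerB_dist _ _))// distrC.
  exact: ltW.
have H1 : `|F (x, y) - F (p1, y)| <= M * `|x - p1|.
  apply: (@mean_value_le (fun x => F (x, y)) (fun x => P (x, y))) => s ps.
  have bs t : 0 < t -> `|p1 - x| < t -> `|p2 - y| < t -> ball (p1, p2) t (s, y).
    move=> t0 xt yt; apply/ball2E; split => //=; apply: between_dist ps => //.
    exact: pp.
  split; first by apply/is_derive_slice1; apply pF; exact: bs.
  apply: (le_trans (bd _ _ (eP _ (bs _ _ _ _)))) => //.
  by rewrite /M lerD2r lerDl.
have H2 : `|F (p1, y) - F (p1, p2)| <= M * `|y - p2|.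
  apply: (@mean_value_le (fun x => F (p1, x)) (fun x => Q (p1, x))) => s ps.
  have bs t : 0 < t -> `|p2 - y| < t -> ball (p1, p2) t (p1, s).
    move=> t0 yt; apply/ball2E; split => //=; first exact: pp.
    by apply: between_dist ps => //; exact: pp.
  split; first by apply/is_derive_slice2; apply pF; exact: bs.
  apply: (le_trans (bd _ _ (eQ _ (bs _ _ _)))) => //.
  by rewrite /M lerD2r lerDr.
rewrite distrC -(subrK (F (p1, y)) (F (x, y))) -addrA.
rewrite (le_lt_trans (ler_normD _ _))//.
apply: (le_lt_trans (lerD H1 H2)); rewrite -mulrDr -ltr_pdivlMl//.
rewrite (distrC x) (distrC y).
have -> : M^-1 * e = e / (2 * M) + e / (2 * M) by field; rewrite gt_eqF.
exact: ltrD.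
Qed.

Lemma is_derive_integral (f : R -> R) (a x u : R) : a < x -> x < u ->
  (forall t, a <= t <= u -> {for t, continuous f}) ->
  is_derive x 1 (fun z => \int[mu]_(t in `[a, z]) f t) (f x).
Proof.
move=> ax xu cf.
have [] := @continuous_FTC1_closed _ f a x u xu _ ax _.
- exact: integrable_segment.
- by apply: cf; rewrite !ltW.
- by move=> dF; rewrite derive1E => dFE; split.
Qed.

Lemma local_primitive (P Q D : R * R -> R) (p : R * R) (r : R) : 0 < r ->
  (forall x, ball p r x -> [/\ {for x, continuous P}, {for x, continuous Q} &
    {for x, continuous D}]) ->
  (forall x, ball p r x -> is_derive x (0, 1) P (D x)) ->
  (forall x, ball p r x -> is_derive x (1, 0) Q (D x)) ->
  exists F, is_primitive P Q (ball p (r / 2)) F.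
Proof.
case: p => [p1 p2] r0 cPQD dP dQ.
(* Integration starts at a corner rather than at the centre, so that in the ball of radius r / 2
   every upper limit exceeds the lower one; the closed square still lies in the ball of radius r. *)
pose a := p1 - r / 2; pose b := p2 - r / 2.
have bb x y : a <= x <= p1 + r / 2 -> b <= y <= p2 + r / 2 -> ball (p1, p2) r (x, y).
  rewrite /a /b => /andP[? ?] /andP[? ?]; apply/ball2E => /=.
  by rewrite !ltr_norml; split; apply/andP; split; lra.
(* The two L-shaped paths from the corner (a, b) give the same primitive, and each
   of them makes one of the two partial derivatives evident. *)
pose F (q : R * R) := \int[mu]_(s in `[a, q.1]) P (s, b) + \int[mu]_(t in `[b, q.2]) Q (q.1, t).
pose G (q : R * R) := \int[mu]_(t in `[b, q.2]) Q (a, t) + \int[mu]_(s in `[a, q.1]) P (s, q.2).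
have FG q : ball (p1, p2) (r / 2) q -> G q = F q.
  case: q => x y /ball2E[/=]; rewrite !ltr_norml => /andP[? ?] /andP[? ?].
  have bq z : box a x b y z -> ball (p1, p2) r z.
    by case: z => u v /boxE[? ? ? ?]; apply: bb; apply/andP; split; lra.
  rewrite /F /G/=; apply/esym/(@rectangle_closed_form _ P Q D).
  - by rewrite /a; lra.
  - by rewrite /b; lra.
  - by move=> z /bq /cPQD[].
  - by move=> z /bq /cPQD[].
  - by move=> z /bq /cPQD[].
  - by move=> z /bq /dP.
  - by move=> z /bq /dQ.
exists F => -[x y] Bxy; move: (Bxy) => /ball2E[/=].
rewrite !ltr_norml => /andP[? ?] /andP[? ?]; split.
  apply: (@near_eq_is_derive _ _ _ G).
    have nB : nbhs (x, y) (ball (p1, p2) (r / 2)).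
      by apply: open_nbhs_nbhs; split=> //; apply: ball_open; lra.
    by apply: filterS nB => q /FG.
  apply/is_derive_slice1; rewrite /G/=.
  apply: is_derive_val; first apply: is_deriveD_fun (is_derive_cst_fun _ _ _) _.
    apply: (@is_derive_integral (fun s => P (s, y)) a x (p1 + r / 2)); rewrite /a; try lra.
    move=> t tb; apply: continuous_slice1; have [] := cPQD (t, y) _ => //.
    by apply: bb => //; apply/andP; split; rewrite /b; lra.
  by rewrite add0r.
apply/is_derive_slice2; rewrite /F/=.
apply: is_derive_val; first apply: is_deriveD_fun (is_derive_cst_fun _ _ _) _.
  apply: (@is_derive_integral (fun s => Q (x, s)) b y (p2 + r / 2)); rewrite /b; try lra.
  move=> t tb; apply: continuous_slice2; have [] := cPQD (x, t) _ => //.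
  by apply: bb => //; apply/andP; split; rewrite /a; lra.
by rewrite add0r.
Qed.

End local_primitive.

(** * Sums of increments along paths, and their homotopy invariance *)

Section global_primitive.
Context {R : realType} (P Q : R * R -> R).
Set Implicit Arguments.
Unset Strict Implicit.

(* The increment of any primitive defined on a ball containing p and q, and 0 if
   there is no such ball. *)
Definition increment (p q : R * R) : R :=
  xget 0 [set v | exists y r F, [/\ is_primitive P Q (ball y r) F,
    ball y r p, ball y r q & v = F q - F p]].

Lemma incrementE (y : R * R) (r : R) (F : R * R -> R) (p q : R * R) :
  is_primitive P Q (ball y r) F -> ball y r p -> ball y r q ->
  increment p q = F q - F p.
Proof.
move=> pF yp yq; rewrite /increment; case: xgetP => [v _|/(_ (F q - F p)) []].
  move=> [z [s [G [pG zp zq ->]]]].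
  exact: (primitive_increment_unique pG pF).
by exists y, r, F.
Qed.

Lemma increment_telescope (y : R * R) (r : R) (F : R * R -> R) (v : nat -> R * R)
    (m n : nat) : (m <= n)%N ->
  is_primitive P Q (ball y r) F ->
  (forall i, (m <= i <= n)%N -> ball y r (v i)) ->
  \sum_(m <= i < n) increment (v i) (v i.+1) = increment (v m) (v n).
Proof.
move=> mn pF bv; rewrite (incrementE pF); [|by apply: bv; rewrite leqnn mn..].
rewrite -(telescope_sumr (fun i => F (v i)) mn); apply: eq_big_nat => i /andP[mi i_n].
by rewrite (incrementE pF)//; apply: bv; rewrite ?mi ?i_n ?(ltnW i_n) ?(leq_trans mi).
Qed.

Variable U : set (R * R).
Hypothesis locU : forall p, U p -> exists2 r, 0 < r &
  exists F, is_primitive P Q (ball p r) F.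

Lemma incrementxx (p : R * R) : U p -> increment p p = 0.
Proof.
move=> /locU[r r0 [F pF]].
by rewrite (incrementE pF) ?subrr//; exact: ballxx.
Qed.

(** A Lebesgue number: the balls that carry primitives cover the image of the compact set [K], so
    one radius [d] works at all its points. *)
Lemma uniform_primitive (T : pseudoMetricType R) (K : set T) (H : T -> R * R) :
  compact K -> {within K, continuous H} -> (forall z, K z -> U (H z)) ->
  exists2 d, 0 < d & forall x, K x -> exists y r F,
    is_primitive P Q (ball y r) F /\
    (forall z, K z -> ball x d z -> ball y r (H z)).
Proof.
move=> /compact_near_coveringP/near_covering_withinP cK cH UH.
pose Good (d : R) (x : T) := exists y r F, is_primitive P Q (ball y r) F /\
    (forall z, K z -> ball x d z -> ball y r (H z)).
have : \forall d \near 0^'+, K `<=` Good d.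
  apply: cK => x Kx; have [r r0 [F pF]] := locU (UH _ Kx).
  have /subspace_continuousP/(_ x Kx) Hx := cH.
  have : nbhs (H x) (ball (H x) r) by exact: nbhsx_ballx.
  move=> /Hx; rewrite /fmap/= => /nbhs_ballP[e/= e0 eH].
  (* One half of [e] for moving the centre, the other for the radius, by the triangle inequality. *)
  exists (ball x (e / 2), [set i | i < e / 2]).
    split; first by apply: nbhsx_ballx; rewrite divr_gt0.
    by apply: nbhs_right_lt; rewrite divr_gt0.
  move=> [x' d] [/= xx' de] Kx'; exists (H x), r, F; split=> // z Kz x'z.
  apply: eH => //; rewrite (splitr e); apply: ball_triangle xx' _.
  exact: le_ball (ltW de) _ x'z.
move=> nd; have /filter_ex[d [d0 dK]] : \forall d \near 0^'+, 0 < d /\ K `<=` Good d.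
  by apply: filterI => //; exact: nbhs_right_gt.
by exists d.
Qed.

Definition fine_grid (c : R -> R * R) (N : nat) :=
  (0 < N)%N /\ forall i, (i < N)%N -> exists y r F, is_primitive P Q (ball y r) F /\
    (forall s, i%:R / N%:R <= s <= i.+1%:R / N%:R -> ball y r (c s)).

(** Plays the part of the line integral of P dx + Q dy along [c]: on a fine grid each term is the
    increment of a single local primitive. *)
Definition grid_sum (c : R -> R * R) (N : nat) : R :=
  \sum_(0 <= i < N) increment (c (i%:R / N%:R)) (c (i.+1%:R / N%:R)).

Lemma inv_nat_lt (d : R) : 0 < d ->
  exists2 N0, (0 < N0)%N & forall N, (N0 <= N)%N -> N%:R^-1 < d.
Proof.
move=> d0; exists (Num.bound d^-1).+1 => // N NN.
have dN : d^-1 < N%:R.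
  apply: (lt_le_trans (archi_boundP _)); first by rewrite invr_ge0 ltW.
  by rewrite ler_nat ltnW.
by rewrite invf_plt ?posrE// (lt_trans _ dN)// invr_gt0.
Qed.

Lemma grid_le (i N : nat) : (0 < N)%N -> (i <= N)%N -> 0 <= (i%:R / N%:R : R) <= 1.
Proof.
move=> N0 iN; rewrite divr_ge0//= ler_pdivrMr ?ltr0n// mul1r ler_nat//.
Qed.

Lemma gridS (i N : nat) : (0 < N)%N -> (i.+1%:R / N%:R : R) = i%:R / N%:R + N%:R^-1.
Proof. by move=> N0; rewrite -natr1 mulrDl mul1r. Qed.

Lemma path_fine_grid (c : R -> R * R) : path_in U c ->
  exists N0, forall N, (N0 <= N)%N -> fine_grid c N.
Proof.
move=> [cc Uc].
have [d d0 dc] := uniform_primitive (@segment_compact _ 0 1) cc Uc.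
have [N0 N00 dN] := inv_nat_lt d0.
exists N0 => N NN; have Npos := leq_trans N00 NN; split=> // i iN.
have [|y [r [F [pF Fd]]]] := dc (i%:R / N%:R : R).
  by rewrite /= in_itv/= grid_le// ltnW.
exists y, r, F; split=> // s /andP[si sSi]; apply: Fd.
  have /andP[? _] := grid_le Npos (ltnW iN); have /andP[_ ?] := grid_le Npos iN.
  by rewrite /= in_itv/=; apply/andP; split; lra.
have := dN _ NN; move: sSi; rewrite gridS// /ball/= ltr_norml => ? ?.
have : 0 < N%:R^-1 :> R by rewrite invr_gt0 ltr0n.
by move=> ?; apply/andP; split; lra.
Qed.

(** Within one cell of the coarse grid all points lie in the ball of one primitive, so the finer
    increments telescope. Sums with different meshes can then be compared through a common
    multiple. *)
Lemma grid_sum_refine (c : R -> R * R) (N k : nat) : fine_grid c N -> (0 < k)%N ->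
  grid_sum c (N * k) = grid_sum c N.
Proof.
move=> [N0 gc] k0; rewrite /grid_sum big_nat_mul; apply: eq_big_nat => i /andP[_ iN].
have [y [r [F [pF Fc]]]] := gc i iN.
have kR : (0 : R) < k%:R by rewrite ltr0n.
have NR : (0 : R) < N%:R by rewrite ltr0n.
have ek a : (a * k)%:R / (N * k)%:R = a%:R / N%:R :> R.
  by rewrite !natrM; field; rewrite ?gt_eqF.
rewrite (@increment_telescope y r F (fun j => c (j%:R / (N * k)%:R)))//.
- by rewrite !ek.
- by rewrite leq_mul2r leqnSn orbT.
- move=> j /andP[ij ji]; apply: Fc.
  by rewrite -!ek !ler_pM2r ?invr_gt0 ?ltr0n ?muln_gt0 ?N0// !ler_nat ij.
Qed.

(** For a mesh below the Lebesgue number of the homotopy, each cell is mapped into a ball with a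
    primitive, where the two routes between opposite corners have equal increments. This carries the
    sum along the loop, row by row, to the constant loop. *)
Lemma null_homotopic_grid_sum (c : R -> R * R) : null_homotopic U c ->
  exists N0, forall N, (N0 <= N)%N -> grid_sum c N = 0.
Proof.
move=> [H [cH [UH Hc0 Hc1 Hside]]].
have UH' z : (`[0 : R, 1]%classic `*` `[0 : R, 1]%classic) z -> U (H z).
  by case: z => s t [/= s01 t01]; apply: UH.
have [d d0 dH] := uniform_primitive
  (compact_setX (@segment_compact _ 0 1) (@segment_compact _ 0 1)) cH UH'.
have [N0 N00 dN] := inv_nat_lt d0.
exists N0 => N NN; have Npos := leq_trans N00 NN.
have g01 i : (i <= N)%N -> (i%:R / N%:R : R) \in `[0 : R, 1].
  by move=> iN; rewrite in_itv/= grid_le.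
pose v (i j : nat) := H (i%:R / N%:R, j%:R / N%:R).
have cell i j : (i < N)%N -> (j < N)%N ->
    increment (v i j) (v i.+1 j) + increment (v i.+1 j) (v i.+1 j.+1) =
    increment (v i j) (v i j.+1) + increment (v i j.+1) (v i.+1 j.+1).
  move=> iN jN.
  have [|y [r [F [pF Fd]]]] := dH (i%:R / N%:R : R, j%:R / N%:R : R).
    by split; apply: g01; exact: ltnW.
  have bS k : ball (k%:R / N%:R : R) d (k.+1%:R / N%:R).
    rewrite /ball/= gridS// opprD addNKr normrN gtr0_norm ?dN//.
    by rewrite invr_gt0 ltr0n.
  have bb a b : (a = i \/ a = i.+1) -> (b = j \/ b = j.+1) -> ball y r (v a b).
    move=> ai bj; apply: Fd.
      by split; [case: ai|case: bj] => ->; apply: g01 => //; exact: ltnW.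
    by split=> /=; [case: ai => ->|case: bj => ->] => //; exact: ballxx.
  rewrite !(incrementE pF); try by apply: bb; by [left|right].
  by lra.
(* The vertical sides of the grid are constant, so consecutive rows have the same sum. *)
have row j : (j < N)%N -> \sum_(0 <= i < N) increment (v i j) (v i.+1 j) =
    \sum_(0 <= i < N) increment (v i j.+1) (v i.+1 j.+1).
  move=> jN; apply/eqP; rewrite -subr_eq0 -sumrB; apply/eqP.
  rewrite (@eq_big_nat _ _ _ _ _ _ (fun i => - (increment (v i.+1 j) (v i.+1 j.+1)
     - increment (v i j) (v i j.+1)))); last first.
    by move=> i /andP[_ iN]; have := cell _ _ iN jN; lra.
  rewrite sumrN (telescope_sumr (fun i => increment (v i j) (v i j.+1)))//.
  rewrite /v !mul0r divff ?pnatr_eq0 -?lt0n//.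
  have [a0 a1] := Hside _ (g01 _ (ltnW jN)); have [b0 b1] := Hside _ (g01 _ jN).
  by rewrite a0 a1 b0 b1 subrr oppr0.
have rows j : (j <= N)%N -> grid_sum c N = \sum_(0 <= i < N) increment (v i j) (v i.+1 j).
  elim: j => [_|j IH jN]; last by rewrite IH ?(ltnW jN)// row.
  apply: eq_big_nat => i /andP[_ iN].
  by rewrite /v mul0r !Hc0//; apply: g01 => //; exact: ltnW.
(* The last row is the constant loop at the base point, whose increments are 0. *)
rewrite (rows N)// big_nat big1// => i /andP[_ iN].
rewrite /v divff ?pnatr_eq0 -?lt0n// !Hc1; [|by apply: g01; rewrite // ltnW..].
apply: incrementxx; rewrite -(Hc0 0) ?in_itv/= ?lexx ?ler01//.
by apply: UH; rewrite in_itv/= lexx ler01.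
Qed.

End global_primitive.

(** * Primitives on simply connected sets *)

Section simply_connected_primitive.
Context {R : realType} (P Q : R * R -> R).
Set Implicit Arguments.
Unset Strict Implicit.

Definition clamp (a b s : R) : R := Num.min b (Num.max a s).

Lemma clamp_lo (a b s : R) : a <= b -> s <= a -> clamp a b s = a.
Proof. by move=> ab sa; rewrite /clamp (max_idPl sa) (min_idPr ab). Qed.

Lemma clamp_hi (a b s : R) : a <= b -> b <= s -> clamp a b s = b.
Proof. by move=> ab bs; rewrite /clamp (max_idPr (le_trans ab bs)) (min_idPl bs). Qed.

Lemma clamp_id (a b s : R) : a <= s <= b -> clamp a b s = s.
Proof. by move=> /andP[ax xb]; rewrite /clamp (max_idPr ax) (min_idPr xb). Qed.

Lemma clamp_itv (a b s : R) : a <= b -> a <= clamp a b s <= b.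
Proof. by move=> ab; rewrite /clamp le_min ab le_max lexx/= ge_min lexx. Qed.

Lemma clamp_dist (a b s t : R) : a <= b -> `|clamp a b s - clamp a b t| <= `|s - t|.
Proof.
move=> ab; have H (u : R) : [\/ u <= a /\ clamp a b u = a, a <= u <= b /\ clamp a b u = u
    | b <= u /\ clamp a b u = b].
  have [ua|au] := leP u a; first by constructor 1; rewrite clamp_lo.
  have [ub|bu] := leP u b; last by constructor 3; rewrite clamp_hi// ltW.
  by constructor 2; rewrite clamp_id ?ub ?ltW.
rewrite ler_norml.
have := ler_norm (s - t); have := ler_norm (t - s); rewrite (distrC t).
by case: (H s) => -[+ ->]; case: (H t) => -[+ ->];
  try move=> /andP[? ?]; try move=> ?; try move=> /andP[? ?]; move=> *; apply/andP; split; lra.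
Qed.

Lemma continuous_clamp (a b : R) : a <= b -> continuous (clamp a b).
Proof.
move=> ab s; apply/cvgrPdist_lt => e e0; near=> t.
apply: (le_lt_trans (clamp_dist _ _ ab)).
near: t; apply/nbhs_ballP; exists e => //.
Unshelve. all: by end_near. Qed.

(** A path is continuous only within [0, 1]; freezing it at its end values gives a function
    continuous on the whole line, which can be composed and added freely. *)
Lemma continuous_comp_clamp (T : topologicalType) (c : R -> T) :
  {within `[0, 1], continuous c} -> continuous (fun s => c (clamp 0 1 s)).
Proof.
move=> /subspace_continuousP cc s.
have c01 t : `[0, 1]%classic (clamp 0 1 t) by rewrite /= in_itv/= clamp_itv.
move=> A /(cc _ (c01 s)) cA; rewrite /fmap/= in cA.
have h : nbhs s (fun t => `[0, 1]%classic (clamp 0 1 t) -> A (c (clamp 0 1 t))).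
  exact: (continuous_clamp (@ler01 R) cA).
suff : nbhs s (fun t => A (c (clamp 0 1 t))) by [].
by apply: filterS h => t; apply; exact: c01.
Qed.

(* On the successive thirds of [0, 1]: c1, the segment from x to y, and c2 reversed. *)
Definition detour (c1 c2 : R -> R * R) (x y : R * R) (s : R) : R * R :=
  c1 (clamp 0 1 (3 * s)) + clamp 0 1 (3 * s - 1) *: (y - x)
  + (c2 (clamp 0 1 (3 - 3 * s)) - y).

Lemma detour1 (c1 c2 : R -> R * R) (x y : R * R) (s : R) : c2 1 = y ->
  0 <= s <= 1 -> detour c1 c2 x y (s / 3) = c1 s.
Proof.
move=> c2y s01; rewrite /detour mulrC divfK//.
rewrite clamp_id// clamp_lo; [|by lra..].
by rewrite clamp_hi; [|by lra..]; rewrite c2y subrr addr0 scale0r addr0.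
Qed.

Lemma detour2 (c1 c2 : R -> R * R) (x y : R * R) (s : R) : c1 1 = x -> c2 1 = y ->
  0 <= s <= 1 -> detour c1 c2 x y ((1 + s) / 3) = x + s *: (y - x).
Proof.
move=> c1x c2y s01; rewrite /detour mulrC divfK//.
rewrite (@clamp_hi 0 1 (1 + s)); [|by lra..].
rewrite (@clamp_hi 0 1 (3 - _)); [|by lra..].
rewrite (_ : 1 + s - 1 = s); last by lra.
by rewrite clamp_id// c1x c2y subrr addr0.
Qed.

Lemma detour3 (c1 c2 : R -> R * R) (x y : R * R) (s : R) : c1 1 = x ->
  0 <= s <= 1 -> detour c1 c2 x y ((2 + s) / 3) = c2 (1 - s).
Proof.
move=> c1x s01; rewrite /detour mulrC divfK//.
rewrite (@clamp_hi 0 1 (2 + s)); [|by lra..].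
rewrite (@clamp_hi 0 1 (2 + s - 1)); [|by lra..].
rewrite (_ : 3 - (2 + s) = 1 - s); last by lra.
by rewrite (@clamp_id _ _ (1 - s)); [rewrite c1x scale1r subrKC addrC subrK|lra].
Qed.

(** Each of the three terms of [detour] is constant outside its own third of [0, 1], so continuity
    is checked term by term and no pasting is required. *)
Lemma detour_path (U : set (R * R)) (c1 c2 : R -> R * R) (x y : R * R) :
  path_in U c1 -> path_in U c2 -> c1 1 = x -> c2 1 = y ->
  (forall s, 0 <= s <= 1 -> U (x + s *: (y - x))) ->
  path_in U (detour c1 c2 x y).
Proof.
move=> [cc1 Uc1] [cc2 Uc2] c1x c2y Us; split.
  apply: continuous_subspaceT => s; rewrite /detour.
  have lin : {for s, continuous (fun t : R => 3 * t)}.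
    by apply: cvgM; [exact: cvg_cst|exact: cvg_id].
  have lin1 : {for s, continuous (fun t : R => 3 * t - 1)}.
    by apply: cvgB; [exact: lin|exact: cvg_cst].
  have lin3 : {for s, continuous (fun t : R => 3 - 3 * t)}.
    by apply: cvgB; [exact: cvg_cst|exact: lin].
  have k1 : {for s, continuous (fun t : R => c1 (clamp 0 1 (3 * t)))}.
    apply: (@continuous_comp _ _ _ (fun t : R => 3 * t) (fun u => c1 (clamp 0 1 u))) => //.
    exact: continuous_comp_clamp.
  have k2 : {for s, continuous (fun t : R => clamp 0 1 (3 * t - 1) *: (y - x))}.
    apply: cvgZr_tmp.
    apply: (@continuous_comp _ _ _ (fun t : R => 3 * t - 1) (clamp 0 1)) => //.
    exact: continuous_clamp.
  have k3 : {for s, continuous (fun t : R => c2 (clamp 0 1 (3 - 3 * t)))}.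
    apply: (@continuous_comp _ _ _ (fun t : R => 3 - 3 * t) (fun u => c2 (clamp 0 1 u))) => //.
    exact: continuous_comp_clamp.
  exact: (cvgD (cvgD k1 k2) (cvgB k3 (cvg_cst y))).
move=> s; rewrite in_itv/= => /andP[s0 s1].
have [s13|s13] := leP s (1 / 3).
  rewrite (_ : s = (3 * s) / 3); last by lra.
  by rewrite detour1//; [apply: Uc1; rewrite in_itv/=|]; lra.
have [s23|s23] := leP s (2 / 3).
  rewrite (_ : s = (1 + (3 * s - 1)) / 3); last by lra.
  by rewrite detour2//; [apply: Us|]; lra.
rewrite (_ : s = (2 + (3 * s - 2)) / 3); last by lra.
by rewrite detour3//; [apply: Uc2; rewrite in_itv/=|]; lra.
Qed.

Lemma ball_segment (z x y : R * R) (r s : R) : ball z r x -> ball z r y ->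
  0 <= s <= 1 -> ball z r (x + s *: (y - x)).
Proof.
case: z x y => [z1 z2] [x1 x2] [y1 y2] /ball2E[/= + +] /ball2E[/= + +] /andP[s0 s1].
rewrite !ltr_norml => /andP[? ?] /andP[? ?] /andP[? ?] /andP[? ?].
have mix (a b e : R) : a < e -> b < e -> s * a + (1 - s) * b < e.
  move=> ae be; have [->|sn0] := eqVneq s 0; first by lra.
  have : 0 < s * (e - a) by rewrite mulr_gt0 ?subr_gt0// lt_neqAle eq_sym sn0.
  have : 0 <= (1 - s) * (e - b) by rewrite mulr_ge0 ?subr_ge0// ltW.
  by lra.
have conv (u v w e : R) : u - w < e -> u - v < e -> - e < u - w -> - e < u - v ->
    `|u - (v + s * (w - v))| < e.
  move=> ? ? ? ?; rewrite (_ : _ - _ = s * (u - w) + (1 - s) * (u - v)); last by ring.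
  by rewrite ltr_norml; apply/andP; split; [rewrite ltrNl opprD -!mulrN|]; apply: mix; lra.
by apply/ball2E; split=> /=; apply: conv.
Qed.

Variable U : set (R * R).
Hypothesis locU : forall p, U p -> exists r, [/\ 0 < r, ball p r `<=` U &
  exists F, is_primitive P Q (ball p r) F].

Let locU' p : U p -> exists2 r, 0 < r & exists F, is_primitive P Q (ball p r) F.
Proof. by move=> /locU[r [r0 _ pF]]; exists r. Qed.

(** The 3 M steps give M steps to each piece. Along the segment, which stays in the ball by
    convexity, the increments telescope; along [c2] the fine grid puts consecutive points in one
    ball, where reversal changes the sign of an increment. *)
Lemma grid_sum_detour (z x y : R * R) (r : R) (F : R * R -> R) (c1 c2 : R -> R * R) (M : nat) :
  is_primitive P Q (ball z r) F -> ball z r x -> ball z r y ->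
  c1 1 = x -> c2 1 = y -> (0 < M)%N -> fine_grid P Q c2 M ->
  grid_sum P Q (detour c1 c2 x y) (3 * M) =
  grid_sum P Q c1 M + (F y - F x) - grid_sum P Q c2 M.
Proof.
move=> pF zx zy c1x c2y M0 g2.
have MR : (0 : R) < M%:R by rewrite ltr0n.
have idx k i : ((i + k * M)%:R / (3 * M)%:R : R) = (k%:R + i%:R / M%:R) / 3.
  by rewrite natrD !natrM; field; rewrite gt_eqF.
have part k : \sum_(k * M <= i < k.+1 * M) increment P Q
      (detour c1 c2 x y (i%:R / (3 * M)%:R)) (detour c1 c2 x y (i.+1%:R / (3 * M)%:R)) =
    \sum_(0 <= i < M) increment P Q (detour c1 c2 x y ((k%:R + i%:R / M%:R) / 3))
      (detour c1 c2 x y ((k%:R + i.+1%:R / M%:R) / 3)).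
  rewrite -{1}[(k * M)%N]add0n big_addn mulSn addnK; apply: eq_big_nat => i _.
  by rewrite -addSn !idx.
rewrite /grid_sum big_nat_mul !big_nat_recr//= big_geq// add0r !part.
congr (_ + _ + _).
- apply: eq_big_nat => i /andP[_ iM].
  by rewrite !add0r !detour1// grid_le// ltnW.
- transitivity (increment P Q (x + (0%:R / M%:R) *: (y - x)) (x + (M%:R / M%:R) *: (y - x))).
    rewrite -(@increment_telescope _ P Q z r F (fun i => x + (i%:R / M%:R) *: (y - x)))//.
      apply: eq_big_nat => i /andP[_ iM].
      by rewrite !detour2// grid_le// ltnW.
    by move=> i /andP[_ iM]; apply: ball_segment => //; exact: grid_le.
  rewrite mul0r scale0r addr0 divff ?gt_eqF// scale1r subrKC.
  exact: incrementE pF _ _.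
- rewrite big_nat_rev/= add0n -sumrN; apply: eq_big_nat => i /andP[_ iM].
  have h1 : (M - i.+1 <= M)%N by exact: leq_subr.
  have h2 : ((M - i.+1).+1 <= M)%N by rewrite -subSn// subSS leq_subr.
  rewrite !detour3// ?grid_le//.
  have [_ /(_ i iM)[w [s [G [pG Gi]]]]] := g2.
  have e1 : 1 - (M - i.+1)%:R / M%:R = i.+1%:R / M%:R :> R.
    by rewrite natrB//; field; rewrite gt_eqF.
  have e2 : 1 - (M - i.+1).+1%:R / M%:R = i%:R / M%:R :> R.
    by rewrite -subSn// subSS natrB ?(ltnW iM)//; field; rewrite gt_eqF.
  have b1 : ball w s (c2 (i%:R / M%:R)) by apply: Gi; rewrite lexx/= gridS// lerDl invr_ge0 ltW.
  have b2 : ball w s (c2 (i.+1%:R / M%:R)) by apply: Gi; rewrite lexx/= gridS// lerDl invr_ge0 ltW.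
  by rewrite e1 e2 (incrementE pG b1 b2) (incrementE pG b2 b1) opprB.
Qed.

(** [phi] is the grid sum along a chosen path from a base point. The loop made of the path to x, the
    segment to y and the path to y backwards is null-homotopic, so its grid sum is 0, which gives
    the difference of the values of [phi] whatever paths and meshes were chosen. *)
Lemma simply_connected_primitive : @simply_connected R _ U -> exists phi : R * R -> R,
  forall z r F x y, ball z r `<=` U -> is_primitive P Q (ball z r) F ->
    ball z r x -> ball z r y -> phi y - phi x = F y - F x.
Proof.
move=> [pcU scU].
have [[x0 Ux0]|U0] := pselect (exists x0, U x0); last first.
  by exists (fun=> 0) => z r F x y zU _ /zU Ux; exfalso; apply: U0; exists x.
have Hc x : exists cx : R -> R * R, U x -> [/\ path_in U cx, cx 0 = x0 & cx 1 = x].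
  have [Ux|nUx] := pselect (U x); last by exists (fun=> 0).
  by have [cx ?] := pcU _ _ Ux0 Ux; exists cx.
have [c cP] := choice Hc.
have HN x : exists n, U x -> (0 < n)%N /\ forall M, (n <= M)%N -> fine_grid P Q (c x) M.
  have [Ux|nUx] := pselect (U x); last by exists 0%N.
  have [pc _ _] := cP _ Ux; have [n nP] := path_fine_grid locU' pc.
  by exists n.+1 => _; split=> // M nM; apply: nP; exact: ltnW.
have [N NP] := choice HN.
exists (fun x => grid_sum P Q (c x) (N x)) => z r F x y zU pF zx zy.
have [pcx cx0 cx1] := cP _ (zU _ zx); have [pcy cy0 cy1] := cP _ (zU _ zy).
have [Nx NxP] := NP _ (zU _ zx); have [Ny NyP] := NP _ (zU _ zy).
have pd : path_in U (detour (c x) (c y) x y).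
  by apply: detour_path => // s s01; apply: zU; exact: ball_segment.
have d0 : detour (c x) (c y) x y 0 = x0.
  by have := @detour1 (c x) (c y) x y 0 cy1; rewrite mul0r lexx ler01 => ->.
have d1 : detour (c x) (c y) x y 1 = x0.
  have := @detour3 (c x) (c y) x y 1 cx1; rewrite lexx ler01 subrr cy0 => <-//.
  by congr detour; lra.
have [N0 N0P] := null_homotopic_grid_sum locU' (scU _ pd (etrans d0 (esym d1))).
(* A common multiple of both meshes, so that refinement changes neither sum; the factor [N0.+1]
   makes [3 * M] at least [N0]. *)
pose M := (N x * (N y * N0.+1))%N.
have M0 : (0 < M)%N by rewrite !muln_gt0 Nx Ny.
have := N0P (3 * M)%N.
rewrite (grid_sum_detour pF zx zy cx1 cy1 M0); last first.
  by apply: NyP; rewrite /M mulnCA leq_pmulr// muln_gt0 Nx.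
have -> : grid_sum P Q (c x) M = grid_sum P Q (c x) (N x).
  by apply: grid_sum_refine; [exact: NxP|rewrite muln_gt0 Ny].
have -> : grid_sum P Q (c y) M = grid_sum P Q (c y) (N y).
  rewrite /M mulnCA; apply: grid_sum_refine; first exact: NyP.
  by rewrite muln_gt0 Nx.
have -> : (N0 <= 3 * M)%N.
  rewrite /M mulnA [leqRHS]mulnCA mulnA; apply: leq_trans (leqnSn _) _.
  by rewrite mulnA leq_pmull// !muln_gt0 Nx Ny.
by move=> /(_ isT); lra.
Qed.

End simply_connected_primitive.

(** * Logarithmic cutoff *)

Section radial_cutoff.
Context {R : realType}.
Set Implicit Arguments.
Unset Strict Implicit.
Local Notation mu := (@lebesgue_measure R).
Local Notation mu2 := (product_measure1 (@lebesgue_measure R) (@lebesgue_measure R)).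

(** If pi were below 5/2, then 5/4 would exceed pi / 2 and cos (5/4) would be at most 0; but the
    double angle formula and |sin x| <= |x| give cos (5/4) >= 1 - 2 (5/8)^2 > 0. *)
Lemma pi_ge5half : 5 / 2 <= pi :> R.
Proof.
rewrite leNgt; apply/negP => pi52; have pi2 := @pi_ge2 R.
have : 0 <= sin (5 / 4 - pi / 2 : R) by apply: sin_ge0_pi; apply/andP; split; lra.
have sin58 : `|sin (5 / 8 : R) - sin 0| <= 1 * `|5 / 8 - 0|.
  apply: (@mean_value_le _ sin cos) => s _; split; first exact: is_derive_sin.
  by rewrite ler_norml cos_geN1 cos_le1.
rewrite sin0 !subr0 mul1r [X in _ <= X]ger0_norm in sin58; last by lra.
have cos54 : cos (5 / 4 : R) = 1 - 2 * sin (5 / 8) ^+ 2.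
  have := cos2Dsin2 (5 / 8 : R).
  rewrite (_ : 5 / 4 = 5 / 8 + 5 / 8 :> R); last by lra.
  by rewrite cosD -!expr2; lra.
rewrite sinB cos_pihalf sin_pihalf mulr0 mulr1 sub0r cos54.
have : sin (5 / 8 : R) ^+ 2 <= (5 / 8) ^+ 2.
  by rewrite -real_normK ?num_real// lerXn2r ?nnegrE//; lra.
lra.
Qed.

(** Meant for the kinks of [clamp]: the difference quotients of [g] are squeezed by those of [f]. *)
Lemma is_derive0_dominated (f g : R -> R) (x : R) : is_derive x 1 f 0 ->
  (\forall y \near x, `|g y - g x| <= `|f y - f x|) -> is_derive x 1 g 0.
Proof.
move=> [df dfE] gf.
have qf : (fun h => h^-1 *: (f (h *: 1 + x) - f x)) @ 0^' --> (0 : R).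
  by move: (df : _ --> 'D_1 f x); rewrite dfE.
have qg : (fun h => h^-1 *: (g (h *: 1 + x) - g x)) @ 0^' --> (0 : R).
  apply/cvgrPdist_lt => e e0.
  have /nbhs_ballP[r/= r0 rgf] := gf.
  have nf := (cvgr_dist_lt _ _ qf) e e0.
  near=> h.
  have : `|0 - h^-1 *: (f (h *: 1 + x) - f x)| < e by near: h; exact: nf.
  rewrite !sub0r !normrN; apply: le_lt_trans.
  rewrite !normrZ ler_wpM2l//; apply: rgf.
  rewrite /ball/= opprD addrCA subrr addr0 normrN scaler1.
  by near: h; apply: dnbhs0_lt.
split; first by apply/cvg_ex; exists 0.
exact: cvg_lim qg.
Unshelve. all: by end_near. Qed.

(** As [f] vanishes at both ends, the constant extensions match [F] to first order; near an end, the
    increments of the clamped function are either 0 or those of [F]. *)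
Lemma is_derive_clamp (F f : R -> R) (a b : R) : a < b ->
  (forall s : R, a <= s <= b -> is_derive s 1 F (f s)) -> f a = 0 -> f b = 0 ->
  forall s : R, is_derive s 1 (fun t => F (clamp a b t)) (f (clamp a b s)).
Proof.
move=> ab dF fa0 fb0 s; have ab' := ltW ab.
have [sa|ase|sa] := ltgtP s a.
- rewrite clamp_lo ?ltW// fa0.
  apply: near_eq_is_derive (is_derive_cst_fun (F a) s 1).
  by near=> t; rewrite clamp_lo// ltW//; near: t; exact: lt_nbhsl.
- have [sb|sb|sb] := ltgtP s b.
  + rewrite clamp_id ?(ltW ase) ?(ltW sb)//.
    apply: near_eq_is_derive (dF s _); last by rewrite !ltW.
    near=> t; rewrite clamp_id//; apply/andP; split; apply: ltW; near: t.
      exact: lt_nbhsr.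
    exact: lt_nbhsl.
  + rewrite clamp_hi ?ltW// fb0.
    apply: near_eq_is_derive (is_derive_cst_fun (F b) s 1).
    by near=> t; rewrite clamp_hi// ltW//; near: t; exact: lt_nbhsr.
  + rewrite sb clamp_hi// fb0.
    apply: (@is_derive0_dominated F); first by rewrite -fb0; apply: dF; rewrite lexx ltW.
    near=> t; rewrite (@clamp_hi _ a b b)//; have [bt|tb] := leP b t.
      by rewrite clamp_hi// subrr normr0.
    rewrite clamp_id// (ltW tb) andbT ltW//; near: t; exact: lt_nbhsr.
- rewrite sa clamp_lo// fa0.
  apply: (@is_derive0_dominated F); first by rewrite -fa0; apply: dF; rewrite lexx ltW.
  near=> t; rewrite (@clamp_lo _ a b a)//; have [ta|ta] := leP t a.
    by rewrite clamp_lo// subrr normr0.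
  rewrite clamp_id// (ltW ta)/= ltW//; near: t; exact: lt_nbhsl.
Unshelve. all: by end_near. Qed.

Variables (r0 r1 : R).
Hypotheses (r0_gt0 : 0 < r0) (r01 : r0 < r1).

Definition log_ratio : R := ln r1 - ln r0.

Definition log_coord (s : R) : R := (ln s - ln r0) / log_ratio.

(** Its slope vanishes at 0 and at 1, as [is_derive_clamp] requires. *)
Definition smoothstep (l : R) : R := 3 * l ^+ 2 - 2 * l ^+ 3.

(* The primitive of (smoothstep')^2 that vanishes at 0. *)
Definition smoothstep_energy (l : R) : R :=
  12 * l ^+ 3 - 18 * l ^+ 4 + 36 / 5 * l ^+ 5.

(* The cutoff is a smoothstep of the logarithmic coordinate of the squared
   distance s; the flux is designed so that its derivative is
   [2 * s * radial_cut' s ^+ 2]. *)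
Definition radial_cut (s : R) : R := smoothstep (log_coord (clamp r0 r1 s)).

Definition radial_cut' (s : R) : R :=
  let c := clamp r0 r1 s in
  6 * log_coord c * (1 - log_coord c) / (log_ratio * c).

Definition radial_flux (s : R) : R :=
  2 / log_ratio * smoothstep_energy (log_coord (clamp r0 r1 s)).

Lemma log_ratio_gt0 : 0 < log_ratio.
Proof. by rewrite subr_gt0 ltr_ln ?posrE// (lt_trans r0_gt0). Qed.

Let r1_gt0 : 0 < r1. Proof. exact: lt_trans r01. Qed.

Let clamp_gt0 (s : R) : 0 < clamp r0 r1 s.
Proof. by have /andP[+ _] := clamp_itv s (ltW r01); exact: lt_le_trans. Qed.

Lemma log_coord_r0 : log_coord r0 = 0.
Proof. by rewrite /log_coord subrr mul0r. Qed.

Lemma log_coord_r1 : log_coord r1 = 1.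
Proof. by rewrite /log_coord divff// gt_eqF// log_ratio_gt0. Qed.

Lemma log_coord_itv (s : R) : 0 <= log_coord (clamp r0 r1 s) <= 1.
Proof.
have /andP[c0 c1] := clamp_itv s (ltW r01); have L0 := log_ratio_gt0.
rewrite /log_coord divr_ge0 ?subr_ge0 ?ler_ln ?posrE// ?(ltW L0)//=.
rewrite ler_pdivrMr// mul1r lerD2r ler_ln ?posrE//.
exact: ltW. Qed.

Lemma is_derive_log_coord (s : R) : 0 < s ->
  is_derive s 1 log_coord ((log_ratio * s)^-1).
Proof.
move=> s0.
have H := is_deriveM_fun (is_deriveD_fun (is_derive1_ln s0) (is_derive_cst_fun (- ln r0) s 1))
  (is_derive_cst_fun (log_ratio^-1) s 1).
apply: is_derive_val H _.
by have := log_ratio_gt0 => L0; field; rewrite !gt_eqF.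
Qed.

Lemma is_derive_cexp (c : R) (n : nat) (l : R) :
  is_derive l 1 (fun t => c * t ^+ n.+1) (c * (n.+1%:R * l ^+ n)).
Proof.
have H := is_deriveM_fun (is_derive_cst_fun c l 1) (is_deriveX_fun n (is_derive_id l 1)).
by apply: is_derive_val H _; rewrite mul0r add0r mulr1.
Qed.

Lemma is_derive_smoothstep (l : R) : is_derive l 1 smoothstep (6 * l * (1 - l)).
Proof.
have -> : smoothstep = fun t => 3 * t ^+ 2 + (- 2) * t ^+ 3.
  by apply/funext => t; rewrite /smoothstep mulNr.
apply: is_derive_val (is_deriveD_fun (is_derive_cexp 3 1 l) (is_derive_cexp (- 2) 2 l)) _.
by ring.
Qed.

Lemma is_derive_smoothstep_energy (l : R) :
  is_derive l 1 smoothstep_energy ((6 * l * (1 - l)) ^+ 2).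
Proof.
have -> : smoothstep_energy = fun t => 12 * t ^+ 3 + (- 18) * t ^+ 4 + 36 / 5 * t ^+ 5.
  by apply/funext => t; rewrite /smoothstep_energy mulNr.
apply: is_derive_val (is_deriveD_fun (is_deriveD_fun (is_derive_cexp 12 2 l)
  (is_derive_cexp (- 18) 3 l)) (is_derive_cexp (36 / 5) 4 l)) _.
by field.
Qed.

Lemma is_derive_radial_cut (s : R) : is_derive s 1 radial_cut (radial_cut' s).
Proof.
pose F t := smoothstep (log_coord t).
pose f t := 6 * log_coord t * (1 - log_coord t) / (log_ratio * t).
have dF (t : R) : r0 <= t <= r1 -> is_derive t 1 F (f t).
  move=> /andP[rt _]; have t0 := lt_le_trans r0_gt0 rt.
  exact: is_derive_comp_dir (is_derive_smoothstep _) (is_derive_log_coord t0).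
have f0 : f r0 = 0 by rewrite /f log_coord_r0 mulr0 !mul0r.
have f1 : f r1 = 0 by rewrite /f log_coord_r1 subrr mulr0 mul0r.
exact: (is_derive_clamp r01 dF f0 f1 s).
Qed.

Lemma radial_cut'0 (s : R) : s <= r0 \/ r1 <= s -> radial_cut' s = 0.
Proof.
case=> rs; rewrite /radial_cut'.
  by rewrite clamp_lo ?(ltW r01)// log_coord_r0 mulr0 !mul0r.
by rewrite clamp_hi ?(ltW r01)// log_coord_r1 subrr mulr0 !mul0r.
Qed.

Lemma is_derive_radial_flux (s : R) :
  is_derive s 1 radial_flux (2 * s * radial_cut' s ^+ 2).
Proof.
pose F t := 2 / log_ratio * smoothstep_energy (log_coord t).
pose f t := 2 / log_ratio * ((6 * log_coord t * (1 - log_coord t)) ^+ 2 * (log_ratio * t)^-1).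
have dF (t : R) : r0 <= t <= r1 -> is_derive t 1 F (f t).
  move=> /andP[rt _]; have t0 := lt_le_trans r0_gt0 rt.
  have H := is_derive_comp_dir (is_derive_smoothstep_energy _) (is_derive_log_coord t0).
  apply: is_derive_val (is_deriveM_fun (is_derive_cst_fun (2 / log_ratio) t 1) H) _.
  by rewrite mul0r add0r.
have f0 : f r0 = 0 by rewrite /f log_coord_r0 mulr0 mul0r expr0n/= mul0r mulr0.
have f1 : f r1 = 0 by rewrite /f log_coord_r1 subrr mulr0 expr0n/= mul0r mulr0.
apply: is_derive_val (is_derive_clamp r01 dF f0 f1 s) _.
(* Outside (r0, r1) the point s and its clamped value differ, but both expressions vanish there;
   inside, the identity is algebraic. *)
have [sr|rs] := leP s r0.
  by rewrite radial_cut'0; [rewrite clamp_lo ?(ltW r01)// f0 expr0n/= mulr0|left].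
have [rs'|sr'] := leP r1 s.
  by rewrite radial_cut'0; [rewrite clamp_hi ?(ltW r01)// f1 expr0n/= mulr0|right].
have s0 : 0 < s := lt_trans r0_gt0 rs.
have L0 := log_ratio_gt0.
rewrite /radial_cut' clamp_id ?(ltW rs) ?(ltW sr')// /f.
move: (log_coord s) => l; field.
by rewrite !gt_eqF.
Qed.

Lemma radial_cut_itv (s : R) : 0 <= radial_cut s <= 1.
Proof.
rewrite /radial_cut /smoothstep; have := log_coord_itv s.
move: (log_coord _) => l /andP[l0 l1].
have := sqr_ge0 l; have := sqr_ge0 (1 - l) => ? ?; apply/andP; split.
  rewrite (_ : _ - _ = l ^+ 2 * (3 - 2 * l)); last by ring.
  by rewrite mulr_ge0//; lra.
rewrite -subr_ge0 (_ : _ - _ = (1 - l) ^+ 2 * (1 + 2 * l)); last by ring.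
by rewrite mulr_ge0//; lra.
Qed.

Lemma radial_cut0 (s : R) : s <= r0 -> radial_cut s = 0.
Proof.
by move=> sr; rewrite /radial_cut /smoothstep clamp_lo ?(ltW r01)// log_coord_r0 !expr0n/= !mulr0 subrr.
Qed.

Lemma radial_cut1 (s : R) : r1 <= s -> radial_cut s = 1.
Proof.
move=> rs; rewrite /radial_cut /smoothstep clamp_hi ?(ltW r01)// log_coord_r1 !expr1n.
by lra.
Qed.

Lemma radial_flux0 (s : R) : s <= r0 -> radial_flux s = 0.
Proof.
move=> sr; rewrite /radial_flux /smoothstep_energy clamp_lo ?(ltW r01)// log_coord_r0.
by rewrite !expr0n/= !mulr0 subrr addr0 mulr0.
Qed.

(** 12/5 is twice [smoothstep_energy 1], which is 6/5. *)
Lemma radial_flux1 (s : R) : r1 <= s -> radial_flux s = 12 / 5 / log_ratio.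
Proof.
move=> rs; rewrite /radial_flux /smoothstep_energy clamp_hi ?(ltW r01)// log_coord_r1 !expr1n.
by have L0 := log_ratio_gt0; field; rewrite gt_eqF.
Qed.

Lemma continuous_radial_cut' : continuous radial_cut'.
Proof.
move=> s; have L0 := log_ratio_gt0.
have cl : {for s, continuous (fun t => log_coord (clamp r0 r1 t))}.
  apply: (@continuous_comp _ _ _ (clamp r0 r1) log_coord).
    exact: continuous_clamp (ltW r01) _.
  exact: is_derive_continuous (is_derive_log_coord (clamp_gt0 s)).
have cc : {for s, continuous (clamp r0 r1)} by exact: continuous_clamp (ltW r01) _.
apply: cvgM; first apply: cvgM; first apply: cvgM.
- exact: cvg_cst.
- exact: cl.
- apply: cvgB; [exact: cvg_cst|exact: cl].
- apply: cvgV; first by rewrite gt_eqF// mulr_gt0.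
  apply: cvgM; [exact: cvg_cst|exact: cc].
Qed.

(* Radial profile of the field (flux / |x|^2) x, whose divergence is 2 * flux'. *)
Definition flux_profile (s : R) : R := radial_flux s / s.

Definition flux_profile' (s : R) : R :=
  2 * radial_cut' s ^+ 2 - radial_flux s / s ^+ 2.

(** The field is identically 0 near its centre, so the pole of 1 / s is harmless. *)
Lemma flux_profile_near0 (s : R) : s < r0 ->
  \near s, flux_profile s = 0 /\ flux_profile' s = 0.
Proof.
move=> sr; near=> t.
have tr : t <= r0 by apply: ltW; near: t; exact: lt_nbhsl.
rewrite /flux_profile /flux_profile' radial_flux0// radial_cut'0; last by left.
by rewrite expr0n/= mulr0 !mul0r subrr.
Unshelve. all: by end_near. Qed.

Lemma is_derive_flux_profile (s : R) : is_derive s 1 flux_profile (flux_profile' s).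
Proof.
have [sr|rs] := ltP s r0.
  have near0 := flux_profile_near0 sr.
  rewrite (nbhs_singleton near0).2; apply: is_derive_near0.
  by apply: filterS near0 => t [].
have s0 := lt_le_trans r0_gt0 rs.
have sn0 : s != 0 by rewrite gt_eqF.
have H := is_deriveM_fun (is_derive_radial_flux s) (@is_deriveV _ id s 1 1 sn0 (is_derive_id s 1)).
apply: is_derive_val H _.
by rewrite /flux_profile' /GRing.scale/=; field.
Qed.

Lemma continuous_flux_profile' : continuous flux_profile'.
Proof.
move=> s; have [sr|rs] := ltP s r0.
  apply: (@near_cst_continuous _ _ 0).
  by apply: filterS (flux_profile_near0 sr) => t [].
have s0 := lt_le_trans r0_gt0 rs.
apply: cvgB; apply: cvgM.
- exact: cvg_cst.
- by apply: cvgM; exact: continuous_radial_cut'.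
- exact: is_derive_continuous (is_derive_radial_flux s).
- apply: cvgV; first by rewrite expf_neq0// gt_eqF.
  by apply: cvgM; exact: cvg_id.
Qed.

(** With s = |x|^2, the left side is the divergence of the field [flux_profile s] x in the plane,
    and the right side is the squared gradient of the cutoff. *)
Lemma divergence_flux (s : R) :
  2 * flux_profile s + 2 * s * flux_profile' s = 4 * s * radial_cut' s ^+ 2.
Proof.
rewrite /flux_profile /flux_profile'; have [->|s0] := eqVneq s 0.
  by rewrite radial_flux0 ?ltW// mul0r !mulr0 !mul0r addr0.
by field.
Qed.

End radial_cutoff.

(** * Energy of the radial cutoff in the plane *)

Section plane_cutoff.
Context {R : realType}.
Set Implicit Arguments.
Unset Strict Implicit.
Local Notation mu := (@lebesgue_measure R).
Local Notation mu2 := (product_measure1 (@lebesgue_measure R) (@lebesgue_measure R)).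

Lemma le_Rintegral_support (A B : set (R * R)) (f : R * R -> R) :
  measurable A -> measurable B ->
  mu2.-integrable A (EFin \o f) -> mu2.-integrable B (EFin \o f) ->
  (forall p, 0 <= f p) -> (forall p, ~ B p -> f p = 0) ->
  \int[mu2]_(p in A) f p <= \int[mu2]_(p in B) f p.
Proof.
move=> mA mB iA iB f0 fB; rewrite Rintegral_mkcond [leRHS]Rintegral_mkcond.
apply: le_Rintegral => //.
- rewrite -restrict_EFin; apply/integrable_restrict => //; by rewrite setTI.
- rewrite -restrict_EFin; apply/integrable_restrict => //; by rewrite setTI.
- move=> p _; rewrite !patchE; have [pA|pA] := boolP (p \in A).
    by have [//|/negP pB] := boolP (p \in B); rewrite fB// => Bp; apply: pB; rewrite inE.
  by case: ifP.
Qed.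

Lemma continuous_fst2 : continuous (fst : R * R -> R).
Proof. by move=> p; exact: cvg_fst. Qed.

Lemma continuous_snd2 : continuous (snd : R * R -> R).
Proof. by move=> p; exact: cvg_snd. Qed.

Variables (m : R * R).

Definition sqdist (p : R * R) : R := (p.1 - m.1) ^+ 2 + (p.2 - m.2) ^+ 2.

Lemma continuous_off1 : continuous (fun p : R * R => p.1 - m.1).
Proof. by move=> p; apply: cvgB; [exact: continuous_fst2|exact: cvg_cst]. Qed.

Lemma continuous_off2 : continuous (fun p : R * R => p.2 - m.2).
Proof. by move=> p; apply: cvgB; [exact: continuous_snd2|exact: cvg_cst]. Qed.

Lemma continuous_sqdist : continuous sqdist.
Proof.
by move=> p; apply: cvgD; apply: cvgM;
  solve [exact: continuous_off1|exact: continuous_off2].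
Qed.

Lemma continuous_radial (g : R -> R) : continuous g -> continuous (fun p => g (sqdist p)).
Proof.
move=> cg p; apply: (@continuous_comp _ _ _ sqdist g); last exact: cg.
exact: continuous_sqdist.
Qed.

Lemma is_derive_off1 (p : R * R) :
  is_derive p (1, 0) (fun q : R * R => q.1 - m.1) (1 : R) /\
  is_derive p (0, 1) (fun q : R * R => q.1 - m.1) (0 : R).
Proof.
split.
  by apply: is_derive_val (is_deriveD_fun (is_derive_fst1 p) (is_derive_cst_fun (- m.1) p _)) _; rewrite addr0.
by apply: is_derive_val (is_deriveD_fun (is_derive_fst2 p) (is_derive_cst_fun (- m.1) p _)) _; rewrite addr0.
Qed.

Lemma is_derive_off2 (p : R * R) :
  is_derive p (1, 0) (fun q : R * R => q.2 - m.2) (0 : R) /\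
  is_derive p (0, 1) (fun q : R * R => q.2 - m.2) (1 : R).
Proof.
split.
  by apply: is_derive_val (is_deriveD_fun (is_derive_snd1 p) (is_derive_cst_fun (- m.2) p _)) _; rewrite addr0.
by apply: is_derive_val (is_deriveD_fun (is_derive_snd2 p) (is_derive_cst_fun (- m.2) p _)) _; rewrite addr0.
Qed.

Lemma is_derive_sqdist (p : R * R) :
  is_derive p (1, 0) sqdist (2 * (p.1 - m.1)) /\
  is_derive p (0, 1) sqdist (2 * (p.2 - m.2)).
Proof.
have [a1 a2] := is_derive_off1 p; have [b1 b2] := is_derive_off2 p; split.
  apply: is_derive_val (is_deriveD_fun (is_deriveX_fun 1 a1) (is_deriveX_fun 1 b1)) _.
  by rewrite !expr1; ring.
apply: is_derive_val (is_deriveD_fun (is_deriveX_fun 1 a2) (is_deriveX_fun 1 b2)) _.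
by rewrite !expr1; ring.
Qed.

Lemma is_derive_radial (g g' : R -> R) (p : R * R) :
  (forall s : R, is_derive s 1 g (g' s)) ->
  is_derive p (1, 0) (fun q => g (sqdist q)) (g' (sqdist p) * (2 * (p.1 - m.1))) /\
  is_derive p (0, 1) (fun q => g (sqdist q)) (g' (sqdist p) * (2 * (p.2 - m.2))).
Proof.
move=> dg; have [s1 s2] := is_derive_sqdist p.
by split; apply: is_derive_comp_dir.
Qed.

Variables (r0 r1 : R).
Hypotheses (r0_gt0 : 0 < r0) (r01 : r0 < r1) (r1_le1 : r1 <= 1).

Let unit_box := box (m.1 - 1) (m.1 + 1) (m.2 - 1) (m.2 + 1).

(** Opposite sides of the square carry equal flux, so their densities are added first, which turns
    12/5 into 24/5; arctan from -1 to 1 contributes pi / 2. *)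
Let integral_side (u : R) : \int[mu]_(x in `[u - 1, u + 1])
  (24 / 5 / log_ratio r0 r1 * (1 + (x - u) ^+ 2)^-1) = 12 / 5 * pi / log_ratio r0 r1.
Proof.
pose q := 24 / 5 / log_ratio r0 r1.
have dq (x : R) : is_derive x 1 (fun x => q * atan (x - u)) (q * (1 + (x - u) ^+ 2)^-1).
  have H := is_deriveM_fun (is_derive_cst_fun q x 1)
    (is_derive_comp_dir (is_derive1_atan _)
      (is_deriveD_fun (is_derive_id x 1) (is_derive_cst_fun (- u) x 1))).
  by apply: is_derive_val H _; rewrite mul0r add0r addr0 mulr1.
rewrite /Rintegral (@FTC2_is_derive _ (fun x => q * atan (x - u)))//=.
- rewrite addrAC subrr add0r addrAC subrr add0r atanN atan1 /q.
  by have := log_ratio_gt0 r0_gt0 r01 => L0; field; rewrite gt_eqF.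
- by lra.
- move=> x _; apply: cvgM; first exact: cvg_cst.
  apply: cvgV; first by rewrite gt_eqF// ltr_pwDl// sqr_ge0.
  apply: cvgD; first exact: cvg_cst.
  by apply: cvgM; apply: cvgB; solve [exact: cvg_id|exact: cvg_cst].
Qed.

(** Divergence theorem. Since [radial_flux] is constant beyond r1, a square gives the same flux as a
    circle, and its sides involve only one-variable integrals. *)
Lemma integral_radial_energy :
  \int[mu2]_(p in unit_box) (4 * sqdist p * radial_cut' r0 r1 (sqdist p) ^+ 2) =
  24 / 5 * pi / log_ratio r0 r1.
Proof.
pose k := flux_profile r0 r1; pose k' := flux_profile' r0 r1.
have dk (s : R) : is_derive s 1 k (k' s) by exact: is_derive_flux_profile.
have ck : continuous k by move=> s; exact: is_derive_continuous (dk s).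
have ck' : continuous k' by exact: continuous_flux_profile'.
have k1 s : r1 <= s -> k s = 12 / 5 / log_ratio r0 r1 / s.
  by move=> rs; rewrite /k /flux_profile radial_flux1.
pose V1 p := k (sqdist p) * (p.1 - m.1).
pose V2 p := k (sqdist p) * (p.2 - m.2).
pose W1 p := 2 * (p.1 - m.1) ^+ 2 * k' (sqdist p) + k (sqdist p).
pose W2 p := 2 * (p.2 - m.2) ^+ 2 * k' (sqdist p) + k (sqdist p).
have dV1 (p : R * R) : is_derive p (1, 0) V1 (W1 p).
  have H := is_deriveM_fun (is_derive_radial p dk).1 (is_derive_off1 p).1.
  by apply: is_derive_val H _; rewrite /W1; ring.
have dV2 (p : R * R) : is_derive p (0, 1) V2 (W2 p).
  have H := is_deriveM_fun (is_derive_radial p dk).2 (is_derive_off2 p).2.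
  by apply: is_derive_val H _; rewrite /W2; ring.
have cW1 : continuous W1.
  move=> p; apply: cvgD; last exact: continuous_radial.
  apply: cvgM; last exact: continuous_radial.
  by apply: cvgM; [exact: cvg_cst|apply: cvgM; exact: continuous_off1].
have cW2 : continuous W2.
  move=> p; apply: cvgD; last exact: continuous_radial.
  apply: cvgM; last exact: continuous_radial.
  by apply: cvgM; [exact: cvg_cst|apply: cvgM; exact: continuous_off2].
transitivity (\int[mu2]_(p in unit_box) (W1 p + W2 p)).
  apply: eq_Rintegral => p _; rewrite -divergence_flux// /W1 /W2 -/k -/k'.
  by rewrite {2}/sqdist; ring.
rewrite RintegralD//; [|exact: measurable_box|by apply: integrable_box => p _; exact: cW1
  |by apply: integrable_box => p _; exact: cW2].
rewrite (@integral_partial1_box _ V1)//; [|by lra|by move=> p _; exact: cW1].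
rewrite (@integral_partial2_box _ V2)//; [|by lra|by move=> p _; exact: cW2].
(* On a side the squared distance is 1 + (x - u)^2, which is at least r1, so the profile is explicit
   there. *)
have side (u : R) (f : R -> R) :
    (forall x, f x = k (1 + (x - u) ^+ 2) + k (1 + (x - u) ^+ 2)) ->
    \int[mu]_(x in `[u - 1, u + 1]) f x = 12 / 5 * pi / log_ratio r0 r1.
  move=> fE; rewrite -(integral_side u).
  suff fE' (x : R) : f x = 24 / 5 / log_ratio r0 r1 * (1 + (x - u) ^+ 2)^-1.
    by apply: eq_Rintegral => x _; rewrite fE'.
  rewrite fE k1; last by rewrite (le_trans r1_le1)// lerDl sqr_ge0.
  have L0 := log_ratio_gt0 r0_gt0 r01.
  have u0 : 0 < 1 + (x - u) ^+ 2 by rewrite ltr_pwDl// sqr_ge0.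
  move: (1 + _) u0 => w w0; field.
  by rewrite !gt_eqF.
rewrite side; last first.
  by move=> y; rewrite /V1 /sqdist/= addrAC subrr add0r addrAC subrr add0r sqrrN expr1n; ring.
rewrite side; first by field; rewrite gt_eqF// log_ratio_gt0.
move=> x; rewrite /V2 /sqdist/= addrAC subrr add0r addrAC subrr add0r sqrrN expr1n.
by rewrite ![_ + 1]addrC; ring.
Qed.

End plane_cutoff.

(** * The cutoff attached to one segment *)

Section segment_cutoff.
Context {R : realType}.
Set Implicit Arguments.
Unset Strict Implicit.
Local Notation mu2 := (product_measure1 (@lebesgue_measure R) (@lebesgue_measure R)).

Lemma integrable_continuous (D : set (R * R)) (f : R * R -> R) :
  measurable D -> bounded_set D -> continuous f -> mu2.-integrable D (EFin \o f).
Proof.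
move=> mD bD cf; have [M _ DM] := bounded_set_box bD.
have iB : mu2.-integrable (box (- M) M (- M) M) (EFin \o f).
  by apply: integrable_box => p _; exact: cf.
by apply: integrableS iB => //; exact: measurable_box.
Qed.

Lemma logarithmic_cutoff (m : R * R) (h : R) : 0 < h <= 1 ->
  exists psi d1 d2 : R * R -> R,
  [/\ [/\ continuous psi, continuous d1 & continuous d2],
      forall p : R * R, is_derive p (1, 0) psi (d1 p) /\ is_derive p (0, 1) psi (d2 p),
      forall p, 0 <= psi p <= 1,
      (forall p, sqdist m p <= (h / 2) ^+ 2 -> psi p = 0) /\
      (forall p, h / 2 <= sqdist m p -> psi p = 1)
    & forall D : set (R * R), measurable D -> bounded_set D ->
        \int[mu2]_(p in D) (d1 p ^+ 2 + d2 p ^+ 2) <= 24 / 5 * pi * `|ln (h / 2)|^-1].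
Proof.
move=> /andP[h0 h1].
(* These are squared radii. Taking r0 = r1^2 makes ln r1 - ln r0 equal to - ln r1, that is, to |ln
   (h/2)|. *)
pose r1 := h / 2; pose r0 := r1 ^+ 2.
have r1_gt0 : 0 < r1 by rewrite /r1; lra.
have r0_gt0 : 0 < r0 by rewrite exprn_gt0.
have r01 : r0 < r1 by rewrite /r0 expr2 gtr_pMl// /r1; lra.
have r1_le1 : r1 <= 1 by rewrite /r1; lra.
have LE : log_ratio r0 r1 = `|ln (h / 2)|.
  rewrite /log_ratio /r0 lnXn// ltr0_norm; last by rewrite ln_lt0// -/r1 r1_gt0 /r1; lra.
  by rewrite -/r1 mulr2n; lra.
pose psi p := radial_cut r0 r1 (sqdist m p).
pose d1 p := radial_cut' r0 r1 (sqdist m p) * (2 * (p.1 - m.1)).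
pose d2 p := radial_cut' r0 r1 (sqdist m p) * (2 * (p.2 - m.2)).
have dcut := is_derive_radial_cut r0_gt0 r01.
have ccut' := continuous_radial_cut' r0_gt0 r01.
have cd1 : continuous d1.
  move=> p; apply: cvgM; first exact: continuous_radial.
  by apply: cvgM; [exact: cvg_cst|exact: continuous_off1].
have cd2 : continuous d2.
  move=> p; apply: cvgM; first exact: continuous_radial.
  by apply: cvgM; [exact: cvg_cst|exact: continuous_off2].
have energyE p : d1 p ^+ 2 + d2 p ^+ 2 = 4 * sqdist m p * radial_cut' r0 r1 (sqdist m p) ^+ 2.
  by rewrite /d1 /d2 {3}/sqdist; ring.
exists psi, d1, d2; split.
- split=> //; apply: continuous_radial => s; exact: is_derive_continuous (dcut s).
- by move=> p; exact: is_derive_radial.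
- by move=> p; exact: radial_cut_itv.
- by split=> p; [exact: radial_cut0|exact: radial_cut1].
- move=> D mD bD; rewrite -LE -(integral_radial_energy m r0_gt0 r01 r1_le1).
  under [leRHS]eq_Rintegral do rewrite -energyE.
  have ce : continuous (fun p => d1 p ^+ 2 + d2 p ^+ 2).
    by move=> p; apply: cvgD; apply: cvgM; solve [exact: cd1|exact: cd2].
  apply: le_Rintegral_support => //.
  + exact: measurable_box.
  + exact: integrable_continuous.
  + by apply: integrable_box => p _; exact: ce.
  + by move=> p; rewrite addr_ge0// sqr_ge0.
  (* Outside the square of half-side 1 the squared distance is at least 1, hence at least r1, where
     the cutoff has zero derivative. *)
  + case=> p1 p2 np; rewrite energyE radial_cut'0// ?expr0n/= ?mulr0//; right.
    apply: (le_trans r1_le1); rewrite leNgt; apply/negP; rewrite /sqdist/= => lt1.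
    have [u0 v0] := (sqr_ge0 (p1 - m.1), sqr_ge0 (p2 - m.2)).
    have sq (x : R) : x ^+ 2 < 1 -> -1 <= x <= 1.
      by move=> x1; rewrite -ler_norml -(@expr_le1 _ 2)// real_normK ?num_real// ltW.
    have /andP[? ?] : -1 <= p1 - m.1 <= 1 by apply: sq; lra.
    have /andP[? ?] : -1 <= p2 - m.2 <= 1 by apply: sq; lra.
    by apply: np; apply/boxE; split; lra.
Qed.

End segment_cutoff.

(** * Weak derivatives and the trial function *)

Section weak_derivatives.
Context {R : realType}.
Set Implicit Arguments.
Unset Strict Implicit.
Local Notation mu := (@lebesgue_measure R).
Local Notation mu2 := (product_measure1 (@lebesgue_measure R) (@lebesgue_measure R)).

(** The margin 1 puts the sides of the larger box off the support, so the boundary terms of the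
    fundamental theorem are 0. *)
Lemma integral_derivative_support (f F : R * R -> R) (v : R * R) (M : R) :
  v = (1, 0) \/ v = (0, 1) -> 0 < M ->
  continuous F -> (forall p, is_derive p v f (F p)) ->
  (forall p, ~ box (- M) M (- M) M p -> f p = 0) ->
  \int[mu2]_(p in box (- (M + 1)) (M + 1) (- (M + 1)) (M + 1)) F p = 0.
Proof.
move=> vE M0 cF df f0; case: vE => vE; rewrite vE in df.
  rewrite (@integral_partial1_box _ f)//; [|by lra|by move=> p _; exact: cF].
  rewrite (@eq_Rintegral _ _ _ _ _ (fun=> 0)); first by rewrite Rintegral_cst ?mul0r.
  by move=> y _; rewrite !f0 ?subrr// => /boxE[]; lra.
rewrite (@integral_partial2_box _ f)//; [|by lra|by move=> p _; exact: cF].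
rewrite (@eq_Rintegral _ _ _ _ _ (fun=> 0)); first by rewrite Rintegral_cst ?mul0r.
by move=> y _; rewrite !f0 ?subrr// => /boxE[]; lra.
Qed.

Lemma Rintegral_subset_patch (A B : set (R * R)) (f : R * R -> R) : A `<=` B ->
  \int[mu2]_(p in B) (f \_ A) p = \int[mu2]_(p in A) f p.
Proof.
move=> AB; rewrite [LHS]Rintegral_mkcond [RHS]Rintegral_mkcond.
apply: eq_Rintegral => p _; rewrite !patchE.
case: ifPn => // pB; case: ifPn => // pA.
by exfalso; move/negP: pB; apply; rewrite inE; apply: AB; rewrite inE in pA.
Qed.

(** Allows products with [phi] to be extended by 0 across the boundary of Omega: a point outside
    Omega has a neighbourhood that misses the closed support. *)
Lemma test_function_near0 (Omega : set (R * R)) (phi : R * R -> R) (p : R * R) :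
  test_function Omega phi -> ~ Omega p ->
  \near p, phi p = 0 /\ forall v, 'D_v phi p = 0.
Proof.
move=> [_ cK KO] nOp; set K := closure _ in cK KO.
have oK : open (~` K) by apply: closed_openC; exact: closed_closure.
have K0 q : (~` K) q -> phi q = 0.
  by move=> nKq; apply: contrapT => /eqP q0; apply: nKq; exact: subset_closure.
have nK q : (~` K) q -> \near q, phi q = 0.
  by move=> nKq; apply: filterS K0 _; exact: open_nbhs_nbhs.
have : nbhs p (~` K) by apply: open_nbhs_nbhs; split=> // /KO.
apply: filterS => q nKq; split; first exact: K0.
by move=> v; apply: derive_val; exact: is_derive_near0 (nK _ nKq).
Qed.

(** Extended by 0 outside Omega, the product w phi has a continuous derivative in direction v on the
    whole plane, so the integral of this derivative vanishes; the bounds serve to split it into two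
    integrable terms. *)
Lemma weak_partial_classical (Omega : set (R * R)) (w w' : R * R -> R)
    (v : R * R) (M : R) :
  v = (1, 0) \/ v = (0, 1) ->
  open Omega -> bounded_set Omega ->
  (forall p, Omega p -> is_derive p v w (w' p)) ->
  (forall p, Omega p -> {for p, continuous w} /\ {for p, continuous w'}) ->
  (forall p, Omega p -> `|w p| <= M /\ `|w' p| <= M) ->
  weak_partial Omega (fun f => 'D_v f) w w'.
Proof.
move=> vE oO bO dw cw wM phi tphi; have [sphi _ _] := tphi.
have mO := open_measurable2 oO.
have [N N0 ON] := bounded_set_box bO.
have cphi : continuous phi.
  by move=> p; apply: differentiable_continuous; exact: (sphi [::] p I).
have dphi p : is_derive p v phi ('D_v phi p).
  by apply: derivableP; apply: diff_derivable; exact: (sphi [::] p I).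
have cdphi : continuous ('D_v phi).
  move=> p; apply: differentiable_continuous.
  by case: vE => ->; [exact: (sphi [:: false] p I)|exact: (sphi [:: true] p I)].
pose G p := w' p * phi p + w p * 'D_v phi p.
have near_in p : Omega p -> \near p, Omega p by move=> Op; exact: open_nbhs_nbhs.
have near_patch (f : R * R -> R) (p : R * R) : Omega p ->
    \forall q \near p, f q = (f \_ Omega) q.
  by move=> /near_in; apply: filterS => q Oq; rewrite patchE mem_set.
have near0 (p : R * R) : ~ Omega p -> \near p,
    ((fun q => w q * phi q) \_ Omega) p = 0 /\ (G \_ Omega) p = 0.
  move=> /(test_function_near0 tphi); apply: filterS => q [q0 dq0].
  by rewrite !patchE /G q0 dq0 !mulr0 addr0; case: ifP.
have dF p : is_derive p v ((fun q => w q * phi q) \_ Omega) ((G \_ Omega) p).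
  have [Op|nOp] := pselect (Omega p).
    apply: near_eq_is_derive (near_patch _ _ Op) _; rewrite patchE mem_set//.
    exact: is_deriveM_fun (dw _ Op) (dphi p).
  rewrite (nbhs_singleton (near0 _ nOp)).2; apply: is_derive_near0.
  by apply: filterS (near0 _ nOp) => q [].
have cG p : Omega p -> {for p, continuous G}.
  move=> Op; have [cwp cw'p] := cw _ Op.
  by apply: cvgD; apply: cvgM => //; solve [exact: cphi|exact: cdphi].
have cF : continuous (G \_ Omega).
  move=> p; have [Op|nOp] := pselect (Omega p).
    have E : (G \_ Omega) p = G p by rewrite patchE mem_set.
    rewrite /continuous_at E; apply: cvg_trans (cG _ Op).
    by apply: near_eq_cvg; exact: near_patch.
  apply: (@near_cst_continuous _ _ 0).
  by apply: filterS (near0 _ nOp) => q [].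
have f0 p : ~ box (- N) N (- N) N p -> ((fun q => w q * phi q) \_ Omega) p = 0.
  by move=> np; rewrite patchE; case: ifPn => //; rewrite inE => /ON.
have := integral_derivative_support vE N0 cF dF f0.
rewrite Rintegral_subset_patch; last first.
  by case=> x y /ON /boxE[? ? ? ?]; apply/boxE; split; lra.
have intM (f g : R * R -> R) : (forall p, Omega p -> {for p, continuous f}) ->
    (forall p, Omega p -> `|f p| <= M) -> continuous g ->
    mu2.-integrable Omega (EFin \o (fun p => f p * g p)).
  move=> cf fM cg.
  have [K gK] := @compact_bound _ _ g (@compact_box _ (- N) N (- N) N) (fun p _ => cg p).
  apply: (@bounded_integrable2 _ _ _ (M * K)) => //.
    by apply: measurable_fun_cts => // p Op; apply: cvgM; [exact: cf|exact: cg].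
  by move=> p Op; rewrite normrM ler_pM// ?fM// gK//; exact: ON.
rewrite /G RintegralD//; last 2 first.
- by apply: intM => // p Op; [exact: (cw _ Op).2|exact: (wM _ Op).2].
- by apply: intM => // p Op; [exact: (cw _ Op).1|exact: (wM _ Op).1].
by move=> /eqP; rewrite addrC addr_eq0 => /eqP.
Qed.

End weak_derivatives.

(** * Regularity of the potential, its primitive off the cut, and segments in discs *)

Section potential.
Context {R : realType}.
Set Implicit Arguments.
Unset Strict Implicit.

(** At a point of the open set Omega the local smooth extension agrees with [f] in a full
    neighbourhood, so its derivatives are those of [f]. *)
Lemma smooth_on_interior (X Omega : set (R * R)) (f : R * R -> R) (p : R * R) :
  smooth_on X f -> open Omega -> Omega `<=` X -> Omega p ->
  [/\ {for p, continuous f}, forall v, is_derive p v f ('D_v f p)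
    & {for p, continuous (partial1 f)} /\ {for p, continuous (partial2 f)}].
Proof.
move=> sf oO OX Op; have [V [g [oV Vp sg gf]]] := sf p (OX _ Op).
have Vg q : V q -> differentiable g q by move=> Vq; exact: (sg [::] q Vq).
have oVO : open (V `&` Omega) by exact: openI.
have eqVO q : (V `&` Omega) q -> \forall x \near q, g x = f x.
  move=> VOq; have : nbhs q (V `&` Omega) by exact: open_nbhs_nbhs.
  by apply: filterS => x [Vx Ox]; rewrite gf// inE; split=> //; exact: OX.
have VOp : (V `&` Omega) p by [].
have cnear (h k : R * R -> R) : (\near p, h p = k p) -> {for p, continuous h} ->
    {for p, continuous k}.
  move=> hk ch; rewrite /prop_for /continuous_at -(nbhs_singleton hk); apply: cvg_trans ch.
  by apply: near_eq_cvg; apply: filterS hk => x ->.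
split.
- by apply: cnear (eqVO _ VOp) _; apply: differentiable_continuous; exact: Vg.
- move=> v; rewrite -(near_eq_derive v (eqVO _ VOp)).
  apply: near_eq_is_derive (eqVO _ VOp) _.
  by apply: derivableP; apply: diff_derivable; exact: Vg.
- have nVO : nbhs p (V `&` Omega) by exact: open_nbhs_nbhs.
  split.
    apply: (cnear (partial1 g)).
      by apply: filterS nVO => x VOx; exact: near_eq_derive (eqVO _ VOx).
    by apply: differentiable_continuous; exact: (sg [:: false] p Vp).
  apply: (cnear (partial2 g)).
    by apply: filterS nVO => x VOx; exact: near_eq_derive (eqVO _ VOx).
  by apply: differentiable_continuous; exact: (sg [:: true] p Vp).
Qed.

(** Smoothness up to the boundary gives continuity within the compact closure; this is what bounds
    the potential on Omega. *)
Lemma smooth_on_bounded (X : set (R * R)) (f : R * R -> R) :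
  compact X -> smooth_on X f -> exists M, forall p, X p -> `|f p| <= M.
Proof.
move=> cX sf.
have cf : {within X, continuous f}.
  apply/subspace_continuousP => p Xp.
  have [V [g [oV Vp sg gf]]] := sf p Xp.
  have cg : {for p, continuous g} by apply: differentiable_continuous; exact: (sg [::] p Vp).
  have cg' : g @ p --> f p by rewrite gf ?inE.
  apply: (@cvg_trans _ (g @ within X (nbhs p))); last first.
    by apply: cvg_trans cg'; apply: cvg_app; exact: cvg_within.
  apply: near_eq_cvg; rewrite near_withinE.
  have : nbhs p V by exact: open_nbhs_nbhs.
  by apply: filterS => q Vq Xq; rewrite -gf ?inE.
have [M [Mr bM]] := compact_bounded (continuous_compact cf cX).
exists (M + 1) => x Xx.
by apply: (bM (M + 1)); [rewrite ltrDl|exists x].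
Qed.

Lemma compact_closure_bounded (X : set (R * R)) : bounded_set X -> compact (closure X).
Proof.
move=> /bounded_set_box[M M0 XM].
have cB : closed (box (- M) M (- M) M).
  by apply: compact_closed; [exact: norm_hausdorff|exact: compact_box].
apply: (subclosed_compact _ (@compact_box _ (- M) M (- M) M)); first exact: closed_closure.
by have /closure_id -> := cB; exact: closureS.
Qed.

Lemma closed_segment (s : (R * R) * (R * R)) : closed (segment s).
Proof.
apply: compact_closed; first exact: norm_hausdorff.
apply: continuous_compact; last exact: segment_compact.
apply: continuous_subspaceT => t; apply: cvgD; first exact: cvg_cst.
by apply: cvgZr_tmp; exact: cvg_id.
Qed.

Lemma open_setD_segments (n : nat) (Omega : set (R * R))
    (Gamma : 'I_n -> (R * R) * (R * R)) :
  open Omega -> open (Omega `\` \bigcup_j segment (Gamma j)).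
Proof.
move=> oO; rewrite setDE; apply: openI => //; apply: closed_openC.
by apply: closed_bigcup => [|j _]; [exact: finite_finset|exact: closed_segment].
Qed.

Lemma closed_form_primitive (Omega U : set (R * R)) (A : R * R -> R * R) :
  open Omega -> open U -> U `<=` Omega -> @simply_connected R _ U ->
  potential Omega A -> closed_form Omega A ->
  exists phi : R * R -> R, forall p, U p ->
    [/\ is_derive p (1, 0) phi (A p).1, is_derive p (0, 1) phi (A p).2
      & {for p, continuous phi}].
Proof.
move=> oO oU UO scU [sA1 sA2] clA.
pose P p := (A p).1; pose Q p := (A p).2.
have OcO := @subset_closure _ Omega.
have Pr p (Op : Omega p) := smooth_on_interior sA1 oO OcO Op.
have Qr p (Op : Omega p) := smooth_on_interior sA2 oO OcO Op.
have loc p : U p -> exists r, [/\ 0 < r, ball p r `<=` U &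
    exists F, is_primitive P Q (ball p r) F].
  move=> Up; have /nbhs2P[r r0 rU] : nbhs p U by exact: open_nbhs_nbhs.
  have rO x : ball p r x -> Omega x by move=> /rU /UO.
  exists (r / 2); split; first by rewrite divr_gt0.
    by apply: subset_trans rU; apply: le_ball; lra.
  have cPQD x : ball p r x -> [/\ {for x, continuous P}, {for x, continuous Q} &
      {for x, continuous (partial2 P)}].
    move=> /rO Ox; have [cP _ [_ cD]] := Pr _ Ox; have [cQ _ _] := Qr _ Ox.
    by split.
  have dP x : ball p r x -> is_derive x (0, 1) P (partial2 P x).
    by move=> /rO Ox; have [_ + _] := Pr _ Ox; apply.
  have dQ x : ball p r x -> is_derive x (1, 0) Q (partial2 P x).
    by move=> /rO Ox; rewrite /P -clA//; have [_ + _] := Qr _ Ox; apply.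
  exact: local_primitive r0 cPQD dP dQ.
have [phi phiE] := simply_connected_primitive loc scU.
exists phi => p Up; have [r [r0 rU [F pF]]] := loc p Up.
(* Near p the global function is a local primitive plus a constant, so it inherits the derivatives
   and the continuity. *)
have nphi : \forall x \near p, F x + (phi p - F p) = phi x.
  have : nbhs p (ball p r) by exact: nbhsx_ballx.
  apply: filterS => x px.
  by have := phiE p r F p x rU pF (ballxx _ r0) px; lra.
have [F1 F2] := pF p (ballxx _ r0).
have d0 (v : R * R) (d : R) : is_derive p v F d -> is_derive p v phi d.
  move=> dF; apply: near_eq_is_derive nphi _.
  by apply: is_derive_val (is_deriveD_fun dF (is_derive_cst_fun _ _ _)) _; rewrite addr0.
split; [exact: d0|exact: d0|].
have cF : {for p, continuous F}.
  apply: (primitive_continuous r0 pF).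
    by have [] := Pr _ (UO _ Up).
  by have [] := Qr _ (UO _ Up).
have cFc : (fun x => F x + (phi p - F p)) @ p --> F p + (phi p - F p).
  exact: (cvgD cF (cvg_cst _)).
rewrite subrKC in cFc; apply: cvg_trans cFc.
by apply: near_eq_cvg; apply: filterS nphi => x ->.
Qed.

Definition midpoint (s : (R * R) * (R * R)) : R * R :=
  ((s.1.1 + s.2.1) / 2, (s.1.2 + s.2.2) / 2).

Lemma seg_length_gt0 (s : (R * R) * (R * R)) : s.1 <> s.2 -> 0 < seg_length s.
Proof.
move=> s12; rewrite /seg_length sqrtr_gt0 lt_neqAle addr_ge0 ?sqr_ge0// andbT.
apply/eqP => /esym/eqP; rewrite paddr_eq0 ?sqr_ge0// !sqrf_eq0 !subr_eq0.
move=> /andP[/eqP e1 /eqP e2]; apply: s12.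
by case: s e1 e2 => [[a b] [c d]] /= -> ->.
Qed.

(** The point with parameter t is at squared distance (h/2)^2 - t (1 - t) h^2 from the midpoint, and
    t (1 - t) > 0 away from the end points. *)
Lemma segment_inside_disc (s : (R * R) * (R * R)) (p : R * R) :
  segment s p -> p <> s.1 -> p <> s.2 ->
  sqdist (midpoint s) p < (seg_length s / 2) ^+ 2.
Proof.
move=> [t]; rewrite /= in_itv/= => /andP[t0 t1] <- n1 n2.
have h0 : 0 < seg_length s.
  by apply: seg_length_gt0 => s12; apply: n1; rewrite s12 subrr scaler0 addr0.
have hE : seg_length s ^+ 2 = (s.2.1 - s.1.1) ^+ 2 + (s.2.2 - s.1.2) ^+ 2.
  by rewrite /seg_length sqr_sqrtr// addr_ge0// sqr_ge0.
have tn0 : t != 0 by apply/eqP => t0'; apply: n1; rewrite t0' scale0r addr0.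
have tn1 : t != 1 by apply/eqP => t1'; apply: n2; rewrite t1' scale1r subrKC.
have tt : 0 < t * (1 - t).
  by rewrite mulr_gt0// ?subr_gt0 lt_neqAle ?t0 ?t1 ?tn1 ?andbT// eq_sym.
have -> : sqdist (midpoint s) (s.1 + t *: (s.2 - s.1)) =
    (seg_length s / 2) ^+ 2 - t * (1 - t) * seg_length s ^+ 2.
  rewrite exprMn hE /sqdist /midpoint/=.
  by case: s {n1 n2 h0 hE} => [[a b] [c d]]; rewrite /= /GRing.scale/=; field.
by rewrite ltrBlDr ltrDl mulr_gt0// exprn_gt0.
Qed.

End potential.

(** * The trial function and its Rayleigh quotient *)

Section trial_function.
Context {R : realType}.
Set Implicit Arguments.
Unset Strict Implicit.
Local Notation mu2 := (product_measure1 (@lebesgue_measure R) (@lebesgue_measure R)).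

Lemma L2_on_bounded (Omega : set (R * R)) (f g : R * R -> R) (M : R) :
  open Omega -> bounded_set Omega ->
  (forall p, Omega p -> {for p, continuous f} /\ {for p, continuous g}) ->
  (forall p, Omega p -> `|f p| <= M /\ `|g p| <= M) ->
  L2_on Omega (fun p => Complex (f p) (g p)).
Proof.
move=> oO bO cfg fgM; have mO := open_measurable2 oO; split.
- by apply: measurable_fun_cts => // p /cfg[].
- by apply: measurable_fun_cts => // p /cfg[].
- apply: (@bounded_integrable2 _ _ _ (M ^+ 2 + M ^+ 2)) => //.
    apply: measurable_fun_cts => // p /cfg[cf cg].
    by apply: cvgD; apply: cvgM.
  move=> p /fgM[fM gM]; rewrite /sqmod/= (le_trans (ler_normD _ _))//.
  have sq (x : R) : `|x| <= M -> `|x ^+ 2| <= M ^+ 2.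
    by move=> xM; rewrite normrX lerXn2r// ?nnegrE// (le_trans _ xM).
  by rewrite lerD// sq.
Qed.

(** Without a lower bound for the set, the real number [inf] would not be known to lie below its
    elements. *)
Lemma rayleigh_has_lbound (Omega : set (R * R)) (A : R * R -> R * R) :
  has_lbound (rayleigh_quotients Omega A).
Proof.
exists 0 => _ [u [g1 [g2 [_ _ ->]]]].
have sq0 (z : R[i]) : 0 <= sqmod z by rewrite addr_ge0// sqr_ge0.
by rewrite divr_ge0//; apply: Rintegral_ge0 => // p _; rewrite addr_ge0.
Qed.

Variables (Omega : set (R * R)) (A : R * R -> R * R).
Variables (phi Psi D1 D2 : R * R -> R) (M : R).
Hypotheses (oO : open Omega) (bO : bounded_set Omega) (M0 : 0 <= M).
Hypothesis cPsi : [/\ continuous Psi, continuous D1 & continuous D2].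
Hypothesis dPsi : forall p : R * R, is_derive p (1, 0) Psi (D1 p) /\ is_derive p (0, 1) Psi (D2 p).
Hypothesis bPsi : forall p, Omega p -> [/\ `|Psi p| <= M, `|D1 p| <= M & `|D2 p| <= M].
Hypothesis bA : forall p, Omega p -> `|(A p).1| <= M /\ `|(A p).2| <= M.
Hypothesis cA : forall p, Omega p ->
  {for p, continuous (fun q => (A q).1)} /\ {for p, continuous (fun q => (A q).2)}.
Hypothesis phiP : forall p : R * R, Omega p ->
  (\near p, [/\ Psi p = 0, D1 p = 0 & D2 p = 0]) \/
  [/\ is_derive p (1, 0) phi (A p).1, is_derive p (0, 1) phi (A p).2
    & {for p, continuous phi}].

(** One statement for four uses: [c] is cos or sin, giving the real or imaginary part of Psi exp(i
    phi), and [v] is either axis. In [w'] the derivative of [phi] is replaced by [a]; where this is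
    not justified, Psi and D vanish nearby. *)
Let phase_partial (v : R * R) (D a : R * R -> R) (c c' : R -> R) :
  v = (1, 0) \/ v = (0, 1) ->
  continuous D -> (forall p, is_derive p v Psi (D p)) ->
  (forall p, Omega p -> [/\ `|D p| <= M, `|a p| <= M & {for p, continuous a}]) ->
  (forall p : R * R, Omega p -> (\near p, Psi p = 0 /\ D p = 0) \/
    (is_derive p v phi (a p) /\ {for p, continuous phi})) ->
  (forall s : R, is_derive s 1 c (c' s)) -> continuous c' ->
  (forall s, `|c s| <= 1 /\ `|c' s| <= 1) ->
  let w p := Psi p * c (phi p) in
  let w' p := D p * c (phi p) + Psi p * (c' (phi p) * a p) in
  [/\ weak_partial Omega (fun f => 'D_v f) w w',
      forall p, Omega p -> {for p, continuous w} /\ {for p, continuous w'}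
    & forall p, Omega p -> `|w p| <= M + M * M /\ `|w' p| <= M + M * M].
Proof.
move=> vE cD dD ba phiv dc cc' c1 w w'.
have [cP _ _] := cPsi.
have near0 (p : R * R) : (\near p, Psi p = 0 /\ D p = 0) -> \near p, w p = 0 /\ w' p = 0.
  by apply: filterS => q [q0 d0]; rewrite /w /w' q0 d0 !mul0r addr0.
have bw p : Omega p -> `|w p| <= M + M * M /\ `|w' p| <= M + M * M.
  move=> Op; have [Dp ap _] := ba _ Op; have [Pp _ _] := bPsi Op.
  have [cp c'p] := c1 (phi p).
  have MM0 : 0 <= M * M by rewrite mulr_ge0.
  split; first by rewrite normrM (le_trans (ler_pM _ _ Pp cp))// mulr1 lerDl.
  rewrite (le_trans (ler_normD _ _))// lerD//.
    by rewrite normrM (le_trans (ler_pM _ _ Dp cp))// mulr1.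
  rewrite normrM ler_pM// normrM (le_trans (ler_pM _ _ c'p ap))//.
  by rewrite mul1r.
have cw p : Omega p -> {for p, continuous w} /\ {for p, continuous w'}.
  move=> Op; have [_ _ cap] := ba _ Op; case: (phiv _ Op) => [/near0 n0|[_ cphi]].
    by split; apply: (@near_cst_continuous _ _ 0); apply: filterS n0 => q [].
  have ccp (e : R -> R) : continuous e -> {for p, continuous (fun q => e (phi q))}.
    by move=> ce; apply: (@continuous_comp _ _ _ phi e) => //; exact: ce.
  have cc : continuous c by move=> s; exact: is_derive_continuous (dc s).
  split; first by apply: cvgM; [exact: cP|exact: ccp].
  apply: cvgD; first by apply: cvgM; [exact: cD|exact: ccp].
  apply: cvgM; first exact: cP.
  by apply: cvgM; [exact: ccp|exact: cap].
split=> //; apply: (weak_partial_classical vE oO bO _ cw bw) => p Op.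
case: (phiv _ Op) => [/near0 n0|[dphi _]].
  rewrite (nbhs_singleton n0).2; apply: is_derive_near0.
  by apply: filterS n0 => q [].
exact: is_deriveM_fun (dD p) (is_derive_comp_dir (dc _) dphi).
Qed.

Lemma lambda1_le_energy :
  0 < \int[mu2]_(p in Omega) (Psi p ^+ 2) ->
  lambda1 Omega A <= (\int[mu2]_(p in Omega) (D1 p ^+ 2 + D2 p ^+ 2))
    / \int[mu2]_(p in Omega) (Psi p ^+ 2).
Proof.
move=> Psi_gt0; have [cP cD1 cD2] := cPsi.
have mO := open_measurable2 oO.
have dcos (s : R) : is_derive s 1 cos (- sin s) by exact: is_derive_cos.
have dsin (s : R) : is_derive s 1 sin (cos s) by exact: is_derive_sin.
have ccos : continuous (@cos R) by move=> s; exact: is_derive_continuous (dcos s).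
have cNsin : continuous (fun s : R => - sin s).
  by move=> s; apply: cvgN; exact: is_derive_continuous (dsin s).
have bsin (s : R) : `|sin s| <= 1 /\ `|cos s| <= 1.
  by rewrite !ler_norml sin_geN1 sin_le1 cos_geN1 cos_le1.
have bcos (s : R) : `|cos s| <= 1 /\ `|- sin s| <= 1.
  by rewrite normrN; have [] := bsin s.
have v1 : (1, 0) = (1, 0) :> R * R \/ (1, 0) = (0, 1) :> R * R by left.
have v2 : (0, 1) = (1, 0) :> R * R \/ (0, 1) = (0, 1) :> R * R by right.
have ba1 p : Omega p -> [/\ `|D1 p| <= M, `|(A p).1| <= M & {for p, continuous (fun q => (A q).1)}].
  by move=> Op; have [_ ? _] := bPsi Op; have [? _] := bA Op; have [? _] := cA Op.
have ba2 p : Omega p -> [/\ `|D2 p| <= M, `|(A p).2| <= M & {for p, continuous (fun q => (A q).2)}].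
  by move=> Op; have [_ _ ?] := bPsi Op; have [_ ?] := bA Op; have [_ ?] := cA Op.
have ph1 (p : R * R) : Omega p -> (\near p, Psi p = 0 /\ D1 p = 0) \/
    (is_derive p (1, 0) phi (A p).1 /\ {for p, continuous phi}).
  by move=> /phiP[n0|[? _ ?]]; [left; apply: filterS n0 => q []|right].
have ph2 (p : R * R) : Omega p -> (\near p, Psi p = 0 /\ D2 p = 0) \/
    (is_derive p (0, 1) phi (A p).2 /\ {for p, continuous phi}).
  by move=> /phiP[n0|[_ ? ?]]; [left; apply: filterS n0 => q []|right].
have dP1 p := (dPsi p).1; have dP2 p := (dPsi p).2.
have [w1c cw1c bw1c] := phase_partial v1 cD1 dP1 ba1 ph1 dcos cNsin bcos.
have [w1s cw1s bw1s] := phase_partial v1 cD1 dP1 ba1 ph1 dsin ccos bsin.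
have [w2c cw2c bw2c] := phase_partial v2 cD2 dP2 ba2 ph2 dcos cNsin bcos.
have [w2s cw2s bw2s] := phase_partial v2 cD2 dP2 ba2 ph2 dsin ccos bsin.
pose u p := Complex (Psi p * cos (phi p)) (Psi p * sin (phi p)).
(* The gradient of u with A written for the gradient of phi, on the cut as well; the magnetic
   gradient is thus exp(i phi) times (D1, D2) at every point. *)
pose grad (D a : R * R -> R) p := Complex
  (D p * cos (phi p) + Psi p * (- sin (phi p) * a p))
  (D p * sin (phi p) + Psi p * (cos (phi p) * a p)).
pose g1 := grad D1 (fun p => (A p).1).
pose g2 := grad D2 (fun p => (A p).2).
have sqmod_u p : sqmod (u p) = Psi p ^+ 2.
  rewrite /sqmod/= -[RHS]mulr1 -(cos2Dsin2 (phi p)); ring.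
apply: ge_inf; first exact: rayleigh_has_lbound.
exists u, g1, g2; split.
- split=> //.
  + apply: (@L2_on_bounded _ _ _ (M + M * M)) => // p Op.
      by split; [exact: (cw1c _ Op).1|exact: (cw1s _ Op).1].
    by split; [exact: (bw1c _ Op).1|exact: (bw1s _ Op).1].
  + apply: (@L2_on_bounded _ _ _ (M + M * M)) => // p Op.
      by split; [exact: (cw1c _ Op).2|exact: (cw1s _ Op).2].
    by split; [exact: (bw1c _ Op).2|exact: (bw1s _ Op).2].
  + apply: (@L2_on_bounded _ _ _ (M + M * M)) => // p Op.
      by split; [exact: (cw2c _ Op).2|exact: (cw2s _ Op).2].
    by split; [exact: (bw2c _ Op).2|exact: (bw2s _ Op).2].
(* If u were 0 almost everywhere, the mass of Psi would be 0. *)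
- move=> u0; suff : \int[mu2]_(p in Omega) (Psi p ^+ 2) = 0 by move=> E; rewrite E ltxx in Psi_gt0.
  rewrite /Rintegral (@ae_eq_integral _ _ _ _ _ (fun=> 0%E))// ?integral0//.
  + by apply/measurable_realfun.measurable_EFinP; apply: measurable_fun_cts => // p _; apply: cvgM; exact: cP.
  + case: u0 => N [mN muN uN]; exists N; split=> // p /= np; apply: uN => /= up.
    by apply: np => Op; rewrite -sqmod_u up// /sqmod/= expr0n/= addr0.
- congr (_ / _).
    apply: eq_Rintegral => p _; rewrite /magnetic_gradient_sq /sqmod/=.
    (* Multiplying by cos^2 + sin^2 turns the claim into a polynomial identity. *)
    rewrite -[LHS]mulr1 -[X in _ * X](cos2Dsin2 (phi p)); ring.
  by apply: eq_Rintegral => p _; rewrite sqmod_u.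
Qed.

End trial_function.

(** * Finite families of cutoffs *)

Section finite_families.
Context {R : realType}.
Set Implicit Arguments.
Unset Strict Implicit.
Local Notation mu2 := (product_measure1 (@lebesgue_measure R) (@lebesgue_measure R)).

Lemma common_bound (s : seq R) : exists M, 0 <= M /\ {in s, forall x, x <= M}.
Proof.
elim: s => [|a s [M [M0 sM]]]; first by exists 0.
exists (Num.max a M); split; first by rewrite le_max M0 orbT.
by move=> x; rewrite inE le_max => /predU1P[->|/sM ->]; rewrite ?lexx ?orbT.
Qed.

Lemma is_derive_unique {V : normedModType R} (f : V -> R) (x v : V) (a b : R) :
  is_derive x v f a -> is_derive x v f b -> a = b.
Proof. by move=> [_ <-] [_ <-]. Qed.

(** Cauchy-Schwarz against the constant vector 1, from 2 a b <= a^2 + b^2 summed over all pairs of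
    indices. *)
Lemma sqr_sum_le (n : nat) (a : 'I_n -> R) :
  (\sum_j a j) ^+ 2 <= n%:R * \sum_j a j ^+ 2.
Proof.
have E : n%:R * \sum_j a j ^+ 2 = \sum_i \sum_j (a i ^+ 2 + a j ^+ 2) / 2.
  under [RHS]eq_bigr => i _ do rewrite -mulr_suml big_split/= sumr_const card_ord.
  rewrite -mulr_suml big_split/= sumr_const card_ord.
  have -> : \sum_i a i ^+ 2 *+ n = n%:R * \sum_i a i ^+ 2.
    by rewrite sumrMnl mulr_natl.
  by rewrite -mulr_natl; field.
rewrite E expr2 mulr_suml; apply: ler_sum => i _; rewrite mulr_sumr; apply: ler_sum => j _.
by have := sqr_ge0 (a i - a j); rewrite sqrrB; lra.
Qed.

Lemma continuous_prod (T : topologicalType) (I : Type) (s : seq I) (P : pred I)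
    (f : I -> T -> R) : (forall i, continuous (f i)) ->
  continuous (fun x => \prod_(i <- s | P i) f i x).
Proof.
move=> cf; elim: s => [|i s IH] x.
  by under eq_fun do rewrite big_nil; exact: cvg_cst.
under eq_fun do rewrite big_cons; case: (P i); last exact: IH.
by apply: cvgM; [exact: cf|exact: IH].
Qed.

Lemma continuous_sum (T : topologicalType) (I : Type) (s : seq I) (P : pred I)
    (f : I -> T -> R) : (forall i, continuous (f i)) ->
  continuous (fun x => \sum_(i <- s | P i) f i x).
Proof.
move=> cf; elim: s => [|i s IH] x.
  by under eq_fun do rewrite big_nil; exact: cvg_cst.
under eq_fun do rewrite big_cons; case: (P i); last exact: IH.
by apply: cvgD; [exact: cf|exact: IH].
Qed.

Lemma Rintegral_sum (D : set (R * R)) (I : Type) (s : seq I) (f : I -> R * R -> R) :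
  measurable D -> (forall i, mu2.-integrable D (EFin \o f i)) ->
  mu2.-integrable D (EFin \o (fun p => \sum_(i <- s) f i p)) /\
  \int[mu2]_(p in D) (\sum_(i <- s) f i p) = \sum_(i <- s) \int[mu2]_(p in D) f i p.
Proof.
move=> mD fi; elim: s => [|i s [IH1 IH2]].
  split; last first.
    by rewrite big_nil; under eq_Rintegral do rewrite big_nil; rewrite Rintegral_cst ?mul0r.
  rewrite (_ : _ \o _ = cst 0%E); first exact: integrable0.
  by apply/funext => p /=; rewrite big_nil.
split.
  rewrite (_ : _ \o _ = (EFin \o f i) \+ (EFin \o (fun p => \sum_(i <- s) f i p))).
    exact: integrableD.
  by apply/funext => p /=; rewrite big_cons EFinD.
rewrite big_cons -IH2 -RintegralD//.
by apply: eq_Rintegral => p _; rewrite big_cons.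
Qed.

Lemma lebesgue2_bounded_lty (D : set (R * R)) :
  measurable D -> bounded_set D -> (mu2 D < +oo)%E.
Proof.
move=> mD /bounded_set_box[N _ DN].
apply: (le_lt_trans _ (lebesgue2_box_lty (- N) N (- N) N)).
by apply: le_measure; rewrite ?inE//; exact: measurable_box.
Qed.

Lemma lebesgue2_area (D : set (R * R)) :
  measurable D -> bounded_set D -> mu2 D = (area D)%:E.
Proof.
move=> mD bD; rewrite /area fineK// ge0_fin_numE ?measure_ge0//.
exact: lebesgue2_bounded_lty.
Qed.

Lemma area_gt0 (D : set (R * R)) (p : R * R) :
  open D -> bounded_set D -> D p -> 0 < area D.
Proof.
case: p => x y oD bD Dp; have mD := open_measurable2 oD.
have /nbhs2P[e e0 eD] : nbhs (x, y) D by exact: open_nbhs_nbhs.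
rewrite -lte_fin -lebesgue2_area//.
have BD : box (x - e / 2) (x + e / 2) (y - e / 2) (y + e / 2) `<=` D.
  case=> u v /boxE[? ? ? ?]; apply: eD; apply/ball2E => /=.
  by rewrite !ltr_norml; split; apply/andP; split; lra.
apply: (@lt_le_trans _ _ (mu2 (box (x - e / 2) (x + e / 2) (y - e / 2) (y + e / 2)))).
  by rewrite lebesgue2_box ?lte_fin ?mulr_gt0//; lra.
by apply: le_measure; rewrite ?inE//; exact: measurable_box.
Qed.

(** Pointwise, f is at least 1 minus the sum of the indicators of the boxes: off the boxes f >= 1,
    and on a box that difference is at most 0. *)
Lemma mass_lower_bound (n : nat) (D : set (R * R)) (f : R * R -> R)
    (c : 'I_n -> R * R) (s : 'I_n -> R) :
  let B j := box ((c j).1 - s j) ((c j).1 + s j) ((c j).2 - s j) ((c j).2 + s j) in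
  measurable D -> bounded_set D -> continuous f ->
  (forall j, 0 <= s j) -> (forall p, 0 <= f p) ->
  (forall p, (forall j, ~ B j p) -> 1 <= f p) ->
  area D - \sum_j (2 * s j) ^+ 2 <= \int[mu2]_(p in D) f p.
Proof.
move=> B mD bD cf s0 f0 f1.
have mB j : measurable (B j) by exact: measurable_box.
have iD j : mu2.-integrable D (EFin \o (\1_(B j) : R * R -> R)).
  apply: (@bounded_integrable2 _ _ _ 1) => //.
  by move=> p _; rewrite indicE; case: (_ \in _); rewrite ?normr1 ?normr0.
have [iS ES] := Rintegral_sum (index_enum 'I_n) mD iD.
have i1 : mu2.-integrable D (EFin \o (fun=> 1 : R)).
  by apply: (@bounded_integrable2 _ _ _ 1) => // p _; rewrite normr1.
have intB j : \int[mu2]_(p in D) (\1_(B j) p) <= (2 * s j) ^+ 2.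
  have mBD : measurable (B j `&` D) by exact: measurableI.
  have BDB : (mu2 (B j `&` D) <= ((2 * s j) ^+ 2)%:E)%E.
    have -> : ((2 * s j) ^+ 2)%:E = mu2 (B j).
      have sj := s0 j; rewrite lebesgue2_box; [|lra|lra].
      by congr (_ %:E); ring.
    by apply: le_measure; rewrite ?inE//; exact: mB.
  rewrite /Rintegral integral_indic//; last exact: mB.
  rewrite -[leRHS]/(fine ((2 * s j) ^+ 2)%:E).
  apply: fine_le => //.
  rewrite ge0_fin_numE ?measure_ge0//; exact: le_lt_trans BDB (ltry _).
apply: (@le_trans _ _ (\int[mu2]_(p in D) (1 - \sum_j \1_(B j) p))).
  rewrite RintegralB//= ES Rintegral_cst// mul1r lerD2l lerN2.
  by apply: ler_sum => j _; exact: intB.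
apply: le_Rintegral => //.
- have iB : mu2.-integrable D ((EFin \o (fun=> 1%R)) \-
      (EFin \o (fun p : R * R => (\sum_j \1_(B j) p)%R)))%E by exact: integrableB.
  by apply: eq_integrable iB => // p _; rewrite /= EFinB.
- exact: integrable_continuous.
move=> p _; have [nB|/existsNP[j /contrapT Bj]] := pselect (forall j, ~ B j p).
  by apply: le_trans (f1 _ nB); rewrite lerBlDr lerDl sumr_ge0.
apply: le_trans (f0 p); rewrite subr_le0 (bigD1 j)//= indicE mem_set//= lerDl.
by rewrite sumr_ge0.
Qed.

Lemma sqdist_lt_box (m p : R * R) (r : R) : 0 <= r -> sqdist m p < r ^+ 2 ->
  box (m.1 - r) (m.1 + r) (m.2 - r) (m.2 + r) p.
Proof.
case: p => x y r0; rewrite /sqdist/= => lt_r.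
have [u0 v0] := (sqr_ge0 (x - m.1), sqr_ge0 (y - m.2)).
have sq (z : R) : z ^+ 2 <= r ^+ 2 -> - r <= z <= r.
  by move=> zr; rewrite -ler_norml -(@ler_pXn2r _ 2) ?nnegrE// real_normK ?num_real.
have /andP[? ?] : - r <= x - m.1 <= r by apply: sq; lra.
have /andP[? ?] : - r <= y - m.2 <= r by apply: sq; lra.
by apply/boxE; split; lra.
Qed.

End finite_families.

(** * Product of the cutoffs of all segments, and the final estimate *)

Theorem theorem5 (R : realType) (n : nat) (Omega : set (R * R))
    (A : R * R -> R * R) (Gamma : 'I_n -> (R * R) * (R * R))
    (hOmega : smooth_domain_with_holes n Omega)
    (hA : potential Omega A) (hAclosed : closed_form Omega A)
    (hcut : admissible_cut Omega Gamma)
    (hmin : \sum_(j < n) seg_length (Gamma j) = cut_const n Omega)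
    (harea : cut_const n Omega <= area Omega / (2 * pi))
    (hlen : forall j : 'I_n, seg_length (Gamma j) <= 1) :
  lambda1 Omega A <=
    8 * pi * n%:R / area Omega *
    \sum_(j < n) `| ln (seg_length (Gamma j) / 2) |^-1.
Proof.
have [oO _ bO [c [_ _ bdO _ _]]] := hOmega.
have mO := open_measurable2 oO.
(* A connected set may be empty; the outer boundary curve excludes this, as the empty set has empty
   boundary. *)
have [x0 Ox0] : exists x, Omega x.
  apply: contrapT => nO; have O0 : Omega = set0.
    by rewrite -subset0 => x Ox; apply: nO; exists x.
  have : boundary Omega (c ord0 0) by rewrite bdO; exists ord0 => //; exists 0.
  by rewrite O0 /boundary closure0 => -[].
have area0 := area_gt0 oO bO Ox0.
have [hjoin hsc] := hcut.
have bd_notin x : boundary Omega x -> ~ Omega x.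
  by move=> [_ nI] Ox; apply: nI; exact: open_nbhs_nbhs.
pose h j := seg_length (Gamma j); pose m j := midpoint (Gamma j).
have h01 j : 0 < h j <= 1.
  (* The end points lie in different components of the boundary, so they are distinct. *)
  rewrite hlen andbT; apply: seg_length_gt0 => e.
  by have [_ _] := hjoin j; rewrite e.
have [phi phiP] := closed_form_primitive oO (@open_setD_segments _ _ _ Gamma oO)
  (@subDsetl _ _ _) hsc hA hAclosed.
have Hcut j : exists t : (R * R -> R) * (R * R -> R) * (R * R -> R),
  [/\ [/\ continuous t.1.1, continuous t.1.2 & continuous t.2],
      forall p : R * R, is_derive p (1, 0) t.1.1 (t.1.2 p) /\ is_derive p (0, 1) t.1.1 (t.2 p),
      forall p, 0 <= t.1.1 p <= 1,
      (forall p, sqdist (m j) p <= (h j / 2) ^+ 2 -> t.1.1 p = 0) /\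
      (forall p, h j / 2 <= sqdist (m j) p -> t.1.1 p = 1)
    & \int[lebesgue2]_(p in Omega) (t.1.2 p ^+ 2 + t.2 p ^+ 2) <= 24 / 5 * pi * `|ln (h j / 2)|^-1].
  have [psi [d1 [d2 [H1 H2 H3 H4 H5]]]] := logarithmic_cutoff (m j) (h01 j).
  by exists (psi, d1, d2); split=> //; exact: H5.
have [t tP] := choice Hcut.
pose psi j := (t j).1.1; pose d1 j := (t j).1.2; pose d2 j := (t j).2.
have cpsi j : continuous (psi j) by have [[]] := tP j.
have cd1 j : continuous (d1 j) by have [[]] := tP j.
have cd2 j : continuous (d2 j) by have [[]] := tP j.
have psi01 j p : 0 <= psi j p <= 1 by have [_ _ + _ _] := tP j; apply.
pose Psi p := \prod_(j < n) psi j p.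
pose grad (d : 'I_n -> R * R -> R) p := \sum_(j < n) d j p * \prod_(k < n | k != j) psi k p.
have cgrad d : (forall j, continuous (d j)) -> continuous (grad d).
  move=> cd; apply: continuous_sum => j p.
  by apply: cvgM; [exact: cd|exact: continuous_prod].
have cPsi : [/\ continuous Psi, continuous (grad d1) & continuous (grad d2)].
  by split; [exact: continuous_prod|exact: cgrad|exact: cgrad].
have dPsi (p : R * R) : is_derive p (1, 0) Psi (grad d1 p) /\ is_derive p (0, 1) Psi (grad d2 p).
  split; apply: is_derive_prod (index_enum_uniq _) _ => j;
    by have [_ /(_ p)[D1 D2] _ _ _] := tP j; solve [exact: D1|exact: D2].
have Psi01 p : 0 <= Psi p <= 1.
  rewrite prodr_ge0/=; last by move=> j _; have /andP[] := psi01 j p.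
  by apply: prodr_ile1 => j _.
have [N N0 ON] := bounded_set_box bO.
have [_ cg1 cg2] := cPsi.
have [K1 K1P] := compact_bound (@compact_box _ (- N) N (- N) N) (fun p _ => cg1 p).
have [K2 K2P] := compact_bound (@compact_box _ (- N) N (- N) N) (fun p _ => cg2 p).
have [M1 M1P] := smooth_on_bounded (compact_closure_bounded bO) hA.1.
have [M2 M2P] := smooth_on_bounded (compact_closure_bounded bO) hA.2.
(* The entry 1 is for Psi, K1 and K2 for its derivatives, M1 and M2 for the components of A. *)
have [M [M0 leM]] := common_bound [:: 1; K1; K2; M1; M2].
have OcO := @subset_closure _ Omega.
have cA p (Op : Omega p) : {for p, continuous (fun q => (A q).1)} /\
    {for p, continuous (fun q => (A q).2)}.
  have [? _ _] := smooth_on_interior hA.1 oO OcO Op.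
  by have [? _ _] := smooth_on_interior hA.2 oO OcO Op.
have bPsi p : Omega p -> [/\ `|Psi p| <= M, `|grad d1 p| <= M & `|grad d2 p| <= M].
  move=> Op; have /andP[P0 P1] := Psi01 p.
  split; first by rewrite ger0_norm// (le_trans P1)// leM// !inE eqxx.
    by rewrite (le_trans (K1P _ (ON _ Op)))// leM// !inE eqxx ?orbT.
  by rewrite (le_trans (K2P _ (ON _ Op)))// leM// !inE eqxx ?orbT.
have bA p : Omega p -> `|(A p).1| <= M /\ `|(A p).2| <= M.
  move=> Op; split.
    by rewrite (le_trans (M1P _ (OcO _ Op)))// leM// !inE eqxx ?orbT.
  by rewrite (le_trans (M2P _ (OcO _ Op)))// leM// !inE eqxx ?orbT.
have phi_cut (p : R * R) : Omega p ->
    (\near p, [/\ Psi p = 0, grad d1 p = 0 & grad d2 p = 0]) \/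
    [/\ is_derive p (1, 0) phi (A p).1, is_derive p (0, 1) phi (A p).2
      & {for p, continuous phi}].
  move=> Op; have [[j _ sj]|nU] := pselect ((\bigcup_j segment (Gamma j)) p); last first.
    by right; apply: phiP.
  (* The end points of the cuts are not in Omega, so p is in the open disc where
     psi j vanishes. *)
  left; have [b1 b2 _] := hjoin j.
  have in_disc : sqdist (m j) p < (h j / 2) ^+ 2.
    by apply: segment_inside_disc sj _ _ => e;
      [apply: bd_notin b1 _|apply: bd_notin b2 _]; rewrite -e.
  have near_disc (q : R * R) : sqdist (m j) q < (h j / 2) ^+ 2 ->
      \forall x \near q, sqdist (m j) x < (h j / 2) ^+ 2.
    move=> ql; have H : sqdist (m j) @ q --> sqdist (m j) q by exact: continuous_sqdist.
    by apply: (cvgr_lt _ H).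
  have psi0 (q : R * R) : sqdist (m j) q < (h j / 2) ^+ 2 -> psi j q = 0.
    by move=> ql; have [_ _ _ [+ _] _] := tP j; apply; exact: ltW.
  have d0 (q : R * R) : sqdist (m j) q < (h j / 2) ^+ 2 -> d1 j q = 0 /\ d2 j q = 0.
    move=> /near_disc nq; have n0 : \near q, psi j q = 0 by apply: filterS nq => x /psi0.
    have [_ /(_ q)[D1 D2] _ _ _] := tP j; split.
      exact: is_derive_unique D1 (is_derive_near0 _ n0).
    exact: is_derive_unique D2 (is_derive_near0 _ n0).
  (* The term of index j vanishes through [d j], every other term through its factor [psi j]. *)
  have grad0 (d : 'I_n -> R * R -> R) q : psi j q = 0 -> d j q = 0 -> grad d q = 0.
    move=> psi0q d0q; rewrite /grad big1// => i _; have [->|ij] := eqVneq i j.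
      by rewrite d0q mul0r.
    by rewrite (bigD1 j) 1?eq_sym//= psi0q mul0r mulr0.
  apply: filterS (near_disc _ in_disc) => q ql; have [d1q d2q] := d0 _ ql.
  split; [|exact: grad0 (psi0 _ ql) d1q|exact: grad0 (psi0 _ ql) d2q].
  by rewrite /Psi (bigD1 j)//= psi0// mul0r.
have hsum : \sum_j h j <= area Omega / (2 * pi) by rewrite hmin.
have pi52 := @pi_ge5half R.
have mass : (1 - pi^-1) * area Omega <= \int[lebesgue2]_(p in Omega) (Psi p ^+ 2).
  have cP2 : continuous (fun p => Psi p ^+ 2).
    by have [cP _ _] := cPsi => p; apply: cvgM; exact: cP.
  (* Each disc of radius sqrt (h_j / 2) is enclosed in a square of area 2 h_j. *)
  apply: le_trans (mass_lower_bound (c := m) (s := fun j => Num.sqrt (h j / 2)) mO bO cP2 _ _ _).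
  - have -> : \sum_j (2 * Num.sqrt (h j / 2)) ^+ 2 = 2 * \sum_j h j.
      rewrite mulr_sumr; apply: eq_bigr => j _; have /andP[? _] := h01 j.
      by rewrite exprMn sqr_sqrtr; [field|lra].
    have -> : (1 - pi^-1) * area Omega = area Omega - 2 * (area Omega / (2 * pi)).
      by rewrite invfM; move: pi^-1 => q; field.
    by lra.
  - by move=> j; exact: sqrtr_ge0.
  - by move=> p; exact: sqr_ge0.
  - move=> p nB; rewrite [Psi p]big1 ?expr1n// => j _.
    have [_ _ _ [_ +] _] := tP j; apply; rewrite leNgt; apply/negP => lt_h.
    apply: (nB j); apply: sqdist_lt_box; first exact: sqrtr_ge0.
    by have /andP[? _] := h01 j; rewrite sqr_sqrtr// divr_ge0// ltW.
have pi0 : 0 < pi :> R := pi_gt0 R.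
have mass0 : 0 < (1 - pi^-1) * area Omega.
  by rewrite mulr_gt0// subr_gt0 invf_lt1//; lra.
apply: le_trans (lambda1_le_energy oO bO M0 cPsi dPsi bPsi bA cA phi_cut _) _.
  exact: lt_le_trans mass.
pose S := \sum_(j < n) `|ln (h j / 2)|^-1.
have S0 : 0 <= S by rewrite sumr_ge0// => j _; rewrite invr_ge0.
(* The cofactors are products of numbers in [0, 1], so only the number of terms enters the
   constant. *)
have grad_le d p : grad d p ^+ 2 <= n%:R * \sum_j d j p ^+ 2.
  apply: le_trans (sqr_sum_le _) _; rewrite ler_wpM2l//; apply: ler_sum => j _.
  rewrite exprMn ler_piMr ?sqr_ge0// exprn_ile1//.
    by rewrite prodr_ge0// => k _; have /andP[] := psi01 k p.
  by apply: prodr_ile1 => k _.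
have ce j : continuous (fun p => d1 j p ^+ 2 + d2 j p ^+ 2).
  by move=> p; apply: cvgD; apply: cvgM; solve [exact: cd1|exact: cd2].
have energy : \int[lebesgue2]_(p in Omega) (grad d1 p ^+ 2 + grad d2 p ^+ 2) <=
    n%:R * (24 / 5 * pi * S).
  have ie j := integrable_continuous mO bO (ce j).
  have [isum Esum] := Rintegral_sum (index_enum 'I_n) mO ie.
  apply: (@le_trans _ _ (\int[lebesgue2]_(p in Omega)
      (n%:R * \sum_j (d1 j p ^+ 2 + d2 j p ^+ 2)))).
    apply: le_Rintegral => //.
    - apply: integrable_continuous => // p.
      by apply: cvgD; apply: cvgM; solve [exact: cg1|exact: cg2].
    - apply: integrable_continuous => // p.
      by apply: cvgM; [exact: cvg_cst|exact: continuous_sum].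
    - move=> p _; rewrite big_split/= mulrDr.
      by apply: lerD; exact: grad_le.
  rewrite RintegralZl// Esum ler_wpM2l// mulr_sumr.
  by apply: ler_sum => j _; have [_ _ _ _] := tP j.
have n0 : 0 <= n%:R :> R by [].
rewrite ler_pdivrMr; last exact: lt_le_trans mass.
apply: (le_trans energy).
apply: (@le_trans _ _ (8 * pi * n%:R / area Omega * S * ((1 - pi^-1) * area Omega))); last first.
  by rewrite ler_wpM2l// mulr_ge0// divr_ge0 ?(ltW area0)// !mulr_ge0// ltW.
(* Once the area cancels, the comparison is 24/5 pi <= 8 (pi - 1), that is, pi >= 5/2. *)
have arith (q a N' s : R) : 0 < q -> 0 < a ->
    8 * q * N' / a * s * ((1 - q^-1) * a) = N' * (8 * (q - 1) * s).
  by move=> q0 a0; field; rewrite !gt_eqF.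
rewrite arith//.
by rewrite ler_wpM2l// ler_wpM2r//; lra.
Qed.
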